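(* Let $k$ be an algebraically closed field, let $S=k[[u,v]]$, let $G\subseteq \mathrm{GL}(2,k)$ be a finite small group such that $\operatorname{char} k$ does not divide $|G|$, let $G$ act on $S$ by linear changes of variables, and let $R=S^G$. Let $V$ be a finitely generated $k[G]$-module and let $M=(S\otimes_k V)^G$. Then for every natural number $q$ there is an isomorphism of $R$-modules $$\left(\mathrm{Sym}_R^q(M)\right)^{**}\cong \left(S\otimes_k \mathrm{Sym}_k^q(V)\right)^G .$$ In other words, $\left(\mathrm{Sym}_R^{q}(\mathcal{A}(V))\right)^{**}\cong\mathcal{A}(\mathrm{Sym}^{q}_{k}(V))$, where $\mathcal{A}(W):=(S\otimes_k W)^G$ for every finitely generated $k[G]$-module $W$.
   Context: A finite subgroup $G\subseteq\mathrm{GL}(2,k)$ is small if it contains no pseudo-reflections. $k[G]$ is the group ring; finitely generated $k[G]$-modules are the same as finite-dimensional $k$-linear representations of $G$. $G$ acts diagonally on $S\otimes_k W$: $g(s\otimes w)=g(s)\otimes g(w)$; $(-)^G$ denotes $G$-invariants. $\mathrm{Sym}^q_R(-)$ is the $q$-th symmetric power of $R$-modules and $\mathrm{Sym}^q_k(V)$ is the $q$-th symmetric power of the representation $V$ (with its induced $G$-action). On $R$-modules $(-)^*=\mathrm{Hom}_R(-,R)$, and $(-)^{**}$ is the double dual (reflexive hull). *)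

(* Defs.v *)
From HB Require Import structures.
From mathcomp Require Import all_boot all_order all_algebra perm.
From mathcomp Require Import finmap boolp functions.
From mathcomp Require Import freeg mpoly.

Set Implicit Arguments.
Unset Strict Implicit.
Unset Printing Implicit Defensive.

Import GRing.Theory.

Local Open Scope ring_scope.
Local Open Scope quotient_scope.

Section LinearSpan.
Variables (A : nzRingType) (V : lmodType A) (E : V -> Prop).

(* the smallest submodule of V containing E *)
Definition lspan : {pred V} := [pred x : V | `[< forall P : V -> Prop,
  P 0 -> (forall a y z, P y -> P z -> P (a *: y + z)) ->
  (forall y, E y -> P y) -> P x >] ].

Lemma lspan_submod_closed : submod_closed lspan.
Proof.
split; first by rewrite inE; apply/asboolP.
move=> a y z; rewrite !inE => /asboolP Py /asboolP Pz.
apply/asboolP => P P0 PD PE.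
by apply: (PD); [exact: Py | exact: Pz].
Qed.

HB.instance Definition _ :=
  GRing.isSubmodClosed.Build A V lspan lspan_submod_closed.

Lemma mem_lspan y : E y -> y \in lspan.
Proof. by move=> Ey; rewrite inE; apply/asboolP => P _ _; apply. Qed.

Definition quotmod : Type := Quotient.quot lspan.

HB.instance Definition _ := GRing.Zmodule.on quotmod.

Definition quotmod_pi : V -> quotmod := \pi_(Quotient.quot lspan).

Definition quotmod_scale (a : A) (x : quotmod) : quotmod :=
  quotmod_pi (a *: (repr x : V)).

Lemma quotmod_piB : zmod_morphism quotmod_pi.
Proof. exact: pi_is_zmod_morphism. Qed.

HB.instance Definition _ :=
  GRing.isZmodMorphism.Build V quotmod quotmod_pi quotmod_piB.

Lemma quotmod_reprK (x : quotmod) : quotmod_pi (repr x) = x.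
Proof. exact: reprK. Qed.

Lemma quotmod_piP x y : quotmod_pi x = quotmod_pi y <-> x - y \in lspan.
Proof.
split=> [/eqP|] xy; first by rewrite Quotient.idealrBE.
by apply/eqP; rewrite -Quotient.idealrBE.
Qed.

Lemma quotmod_piZ a x : quotmod_scale a (quotmod_pi x) = quotmod_pi (a *: x).
Proof.
apply/quotmod_piP; rewrite -scalerBr; apply: rpredZ.
by apply/quotmod_piP; rewrite quotmod_reprK.
Qed.

Lemma quotmod_scaleA a b x :
  quotmod_scale a (quotmod_scale b x) = quotmod_scale (a * b) x.
Proof. by rewrite -[x]quotmod_reprK !quotmod_piZ scalerA. Qed.

Lemma quotmod_scale1 : left_id 1 quotmod_scale.
Proof. by move=> x; rewrite -[x]quotmod_reprK quotmod_piZ scale1r. Qed.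

Lemma quotmod_scaleDr : right_distributive quotmod_scale +%R.
Proof.
move=> a x y; rewrite -[x]quotmod_reprK -[y]quotmod_reprK -raddfD.
by rewrite !quotmod_piZ scalerDr raddfD.
Qed.

Lemma quotmod_scaleDl x : {morph quotmod_scale^~ x : a b / a + b}.
Proof.
by move=> a b; rewrite -[x]quotmod_reprK !quotmod_piZ scalerDl raddfD.
Qed.

HB.instance Definition _ := GRing.Zmodule_isLmodule.Build A quotmod
  quotmod_scaleA quotmod_scale1 quotmod_scaleDr quotmod_scaleDl.

Lemma quotmod_pi_scalable : scalable quotmod_pi.
Proof. by move=> a x; rewrite -quotmod_piZ. Qed.

HB.instance Definition _ :=
  GRing.isScalable.Build A V quotmod *:%R quotmod_pi quotmod_pi_scalable.

Lemma quotmod_pi0 y : E y -> quotmod_pi y = 0.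
Proof.
by move=> Ey; rewrite -(raddf0 quotmod_pi); apply/quotmod_piP;
   rewrite subr0 mem_lspan.
Qed.

Section Lift.
Variables (W : lmodType A) (f : {linear V -> W}).
Hypothesis fE : forall y, E y -> f y = 0.

Lemma linear_lspan0 y : y \in lspan -> f y = 0.
Proof.
rewrite inE => /asboolP /(_ (fun z => f z = 0)); apply; rewrite ?linear0 //.
move=> a u v fu fv.
by rewrite linearP fu fv scaler0 addr0.
Qed.

Lemma quotmod_liftE x : f (repr (quotmod_pi x)) = f x.
Proof.
apply/subr0_eq; rewrite -linearB linear_lspan0 //.
by apply/quotmod_piP; rewrite quotmod_reprK.
Qed.
End Lift.

End LinearSpan.

Section FreeLift.
Variables (A : nzRingType) (K : choiceType) (W : lmodType A) (f : K -> W).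

Lemma fglift_linear : linear (fglift f : {freeg K / A} -> W).
Proof.
pose F : {additive {freeg K / A} -> W} := HB.pack (fglift f : {freeg K / A} -> W)
  (GRing.isZmodMorphism.Build _ _ (fglift f) (lift_is_additive f)).
move=> a x y; rewrite -[fglift f]/(F : _ -> _) raddfD; congr (_ + _).
have FE D : F D = \sum_(z <- dom D) coeff z D *: f z.
  rewrite -{1}(freeg_sumE D) raddf_sum.
  by apply: eq_bigr => z _ /=; rewrite liftU.
rewrite -[a *: x]/(fgscale a x) /fgscale raddf_sum [F x]FE scaler_sumr.
by apply: eq_bigr => z _ /=; rewrite liftU scalerA.
Qed.

HB.instance Definition _ := GRing.isLinear.Build A {freeg K / A} W *:%R
  (fglift f : {freeg K / A} -> W) fglift_linear.

End FreeLift.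

Lemma freeg_ind (A : nzRingType) (K : choiceType) (P : {freeg K / A} -> Prop) :
  P 0 -> (forall a x y, P y -> P (a *: << x >> + y)) -> forall D, P D.
Proof.
move=> P0 PD D; rewrite -(freeg_sumE D).
elim/big_rec: _ => // x y _ Py.
suff -> : << coeff x D *g x >> = coeff x D *: << x >> :> {freeg K / A}.
  exact: PD.
by apply/eqP/freeg_eqP => z; rewrite coeffZ !coeffU mul1r.
Qed.

Section Tensor.
Variables (A : comNzRingType) (M N : lmodType A).

Inductive tensor_rel : {freeg (M * N)%type / A} -> Prop :=
| TensorRelL a x x' y :
    tensor_rel (<< (a *: x + x', y) >> - (a *: << (x, y) >> + << (x', y) >>))
| TensorRelR a x y y' :
    tensor_rel (<< (x, a *: y + y') >> - (a *: << (x, y) >> + << (x, y') >>)).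

Definition tensor : Type := quotmod tensor_rel.
HB.instance Definition _ := GRing.Lmodule.on tensor.

Definition tens (x : M) (y : N) : tensor := quotmod_pi tensor_rel << (x, y) >>.

Lemma tensPl a x x' y : tens (a *: x + x') y = a *: tens x y + tens x' y.
Proof.
by have := quotmod_pi0 (TensorRelL a x x' y); rewrite linearB linearP => /subr0_eq.
Qed.

Lemma tensPr a x y y' : tens x (a *: y + y') = a *: tens x y + tens x y'.
Proof.
by have := quotmod_pi0 (TensorRelR a x y y'); rewrite linearB linearP => /subr0_eq.
Qed.

Lemma tens0l y : tens 0 y = 0.
Proof.
by have := tensPl (-1) 0 0 y; rewrite scaler0 addr0 scaleN1r addNr.
Qed.

Lemma tensZl a x y : tens (a *: x) y = a *: tens x y.
Proof. by have := tensPl a x 0 y; rewrite tens0l !addr0. Qed.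

Lemma tensor_ind (P : tensor -> Prop) :
  P 0 -> (forall x y t, P t -> P (tens x y + t)) -> forall t, P t.
Proof.
move=> P0 PD t; rewrite -[t](@quotmod_reprK _ _ tensor_rel).
elim/freeg_ind: (repr t) => [|a [x y] D PDD]; first by rewrite raddf0.
by rewrite linearP -[_ *: _]tensZl; apply: PD.
Qed.

Section Lift.
Variables (W : lmodType A) (f : M -> N -> W).
Hypothesis fl : forall y, linear (f^~ y).
Hypothesis fr : forall x, linear (f x).

Definition tensor_lift_ of (forall y, linear (f^~ y)) & (forall x, linear (f x)) :=
  fun t : tensor => fglift (fun p => f p.1 p.2) (repr t) : W.
Local Notation tensor_lift := (tensor_lift_ fl fr).

Let kills D : tensor_rel D -> fglift (fun p => f p.1 p.2) D = 0.
Proof.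
case=> [a x x' y|a x y y']; rewrite linearB linearP /= !liftU /= !scale1r.
  by rewrite fl subrr.
by rewrite fr subrr.
Qed.

Lemma tensor_lift_pi D :
  tensor_lift (quotmod_pi tensor_rel D) = fglift (fun p => f p.1 p.2) D.
Proof. exact: (quotmod_liftE kills). Qed.

Lemma tensor_liftE x y : tensor_lift (tens x y) = f x y.
Proof. by rewrite tensor_lift_pi liftU scale1r. Qed.

Lemma tensor_lift_linear : linear tensor_lift.
Proof.
move=> a s t; rewrite -[s](@quotmod_reprK _ _ tensor_rel).
rewrite -[t](@quotmod_reprK _ _ tensor_rel) -linearP !tensor_lift_pi.
by rewrite linearP.
Qed.

HB.instance Definition _ :=
  GRing.isLinear.Build A tensor W *:%R tensor_lift tensor_lift_linear.
End Lift.

End Tensor.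

Section TensorMap.
Variables (A : comNzRingType) (M M' N N' : lmodType A).
Variables (f : {linear M -> M'}) (g : {linear N -> N'}).

Let bilin x y : tensor M' N' := tens (f x) (g y).

Let bilinl y : linear (bilin^~ y).
Proof. by move=> a x x'; rewrite /bilin linearP tensPl. Qed.

Let bilinr x : linear (bilin x).
Proof. by move=> a y y'; rewrite /bilin linearP tensPr. Qed.

(* the linear map with x (x) y |-> f x (x) g y *)
Definition tensor_map : tensor M N -> tensor M' N' := tensor_lift_ bilinl bilinr.

HB.instance Definition _ := GRing.Linear.on tensor_map.

Lemma tensor_mapE x y : tensor_map (tens x y) = tens (f x) (g y).
Proof. exact: tensor_liftE. Qed.

End TensorMap.

Section SymPower.
Variables (A : comNzRingType) (q : nat) (M : lmodType A).

Definition fupd (x : {ffun 'I_q -> M}) (i : 'I_q) (y : M) : {ffun 'I_q -> M} :=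
  [ffun j => if j == i then y else x j].

Inductive sympow_rel : {freeg {ffun 'I_q -> M} / A} -> Prop :=
| SympowRelLin x i a y z :
    sympow_rel (<< fupd x i (a *: y + z) >>
                - (a *: << fupd x i y >> + << fupd x i z >>))
| SympowRelPerm (x : {ffun 'I_q -> M}) (s : 'S_q) :
    sympow_rel (<< [ffun j => x (s j)] >> - << x >>).

(* the degree q component of the symmetric algebra of M: the q-th tensor power *)
(* of M, presented by generators and multilinear relations, modulo permutation *)
(* of the factors; for q = 0 this is the free module of rank one               *)
Definition sympow : Type := quotmod sympow_rel.
HB.instance Definition _ := GRing.Lmodule.on sympow.

Definition symprod (x : {ffun 'I_q -> M}) : sympow :=
  quotmod_pi sympow_rel << x >>.

Lemma symprodP x i a y z :
  symprod (fupd x i (a *: y + z)) =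
  a *: symprod (fupd x i y) + symprod (fupd x i z).
Proof.
by have := quotmod_pi0 (SympowRelLin x i a y z); rewrite linearB linearP => /subr0_eq.
Qed.

Lemma symprod_perm (x : {ffun 'I_q -> M}) (s : 'S_q) : symprod [ffun j => x (s j)] = symprod x.
Proof.
by have := quotmod_pi0 (SympowRelPerm x s); rewrite linearB => /subr0_eq.
Qed.

Lemma sympow_ind (P : sympow -> Prop) :
  P 0 -> (forall a x t, P t -> P (a *: symprod x + t)) -> forall t, P t.
Proof.
move=> P0 PD t; rewrite -[t](@quotmod_reprK _ _ sympow_rel).
elim/freeg_ind: (repr t) => [|a x D PDD]; first by rewrite raddf0.
by rewrite linearP; apply: PD.
Qed.

End SymPower.

Section SymMap.
Variables (A : comNzRingType) (q : nat) (M N : lmodType A) (f : {linear M -> N}).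

Let gen (x : {ffun 'I_q -> M}) : sympow q N := symprod [ffun j => f (x j)].

(* the linear map with x_1 ... x_q |-> f x_1 ... f x_q *)
Definition sympow_map (t : sympow q M) : sympow q N := fglift gen (repr t).

Let gen_upd x i y : gen (fupd x i y) = symprod (fupd [ffun j => f (x j)] i (f y)).
Proof.
by congr symprod; apply/ffunP => j; rewrite !ffunE; case: ifP.
Qed.

Let kills D : sympow_rel D -> fglift gen D = 0.
Proof.
case=> [x i a y z|x s]; rewrite linearB ?linearP /= !liftU !scale1r.
  by rewrite !gen_upd linearP symprodP scalerN -opprD subrr.
rewrite -[gen x](symprod_perm _ s); apply/eqP; rewrite subr_eq0; apply/eqP.
by congr symprod; apply/ffunP => j; rewrite !ffunE.
Qed.

Let sympow_map_pi D : sympow_map (quotmod_pi (@sympow_rel A q M) D) = fglift gen D.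
Proof. exact: (quotmod_liftE kills). Qed.

Lemma sympow_mapE x : sympow_map (symprod x) = symprod [ffun j => f (x j)].
Proof. by rewrite sympow_map_pi liftU scale1r. Qed.

Lemma sympow_map_linear : linear sympow_map.
Proof.
move=> a s t; rewrite -[s](@quotmod_reprK _ _ (@sympow_rel A q M)).
rewrite -[t](@quotmod_reprK _ _ (@sympow_rel A q M)) -linearP !sympow_map_pi.
by rewrite linearP.
Qed.

HB.instance Definition _ := GRing.isLinear.Build A (sympow q M) (sympow q N) *:%R
  sympow_map sympow_map_linear.

End SymMap.

Section SymFunctor.
Variables (A : comNzRingType) (q : nat).

Lemma sympow_map0 (M N : lmodType A) (f : {linear M -> N}) :
  sympow_map f (0 : sympow q M) = 0.
Proof. exact: linear0. Qed.

Lemma sympow_map_id (M : lmodType A) (f : {linear M -> M}) :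
  f =1 id -> sympow_map f =1 @id (sympow q M).
Proof.
move=> fE; elim/sympow_ind => [|b x t IH]; first exact: sympow_map0.
rewrite sympow_map_linear sympow_mapE IH; congr (_ *: symprod _ + _).
by apply/ffunP => i; rewrite ffunE fE.
Qed.

Lemma sympow_map_comp (M N P : lmodType A) (f : {linear N -> P})
    (g : {linear M -> N}) (h : {linear M -> P}) :
  h =1 f \o g -> sympow_map h =1 sympow_map f \o @sympow_map A q _ _ g.
Proof.
move=> hE; elim/sympow_ind => [|b x t IH]; first by rewrite /comp !sympow_map0.
rewrite /comp !sympow_map_linear !sympow_mapE IH; congr (_ *: symprod _ + _).
by apply/ffunP => i; rewrite !ffunE hE.
Qed.

End SymFunctor.

Section Dual.
Variables (A : comNzRingType) (N : lmodType A).

Definition linear_fun : {pred N -> A^o} := [pred f : N -> A^o | `[< linear f >] ].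

Lemma linear_fun_submod_closed : submod_closed linear_fun.
Proof.
split; first by rewrite inE; apply/asboolP => a x y; rewrite scaler0 addr0.
move=> a f g; rewrite !inE => /asboolP lf /asboolP lg; apply/asboolP => b x y.
rewrite /= -[LHS]/(a *: f (b *: x + y) + g (b *: x + y)) lf lg.
rewrite -[RHS]/(b *: (a *: f x + g x) + (a *: f y + g y)) !scalerDr !scalerA.
by rewrite [a * b]mulrC addrACA.
Qed.

HB.instance Definition _ := GRing.isSubmodClosed.Build A (N -> A^o) linear_fun
  linear_fun_submod_closed.

(* Hom_A(N, A), with pointwise operations *)
Record dual := Dual { dual_fun :> N -> A^o; dual_linear : dual_fun \in linear_fun }.

HB.instance Definition _ := [isSub for dual_fun].
HB.instance Definition _ := [Choice of dual by <:].
HB.instance Definition _ := [SubChoice_isSubLmodule of dual by <:].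

End Dual.

Section PowerSeries.
Variables (n : nat) (k : comNzRingType).

(* k[[x_0, ..., x_(n-1)]], a series being given by its coefficients *)
Record pser := Pser { pscoef : 'X_{1..n} -> k }.

HB.instance Definition _ := [isNew for pscoef].
HB.instance Definition _ := [Choice of pser by <:].

Lemma pserP f g : pscoef f =1 pscoef g <-> f = g.
Proof.
split=> [fg|-> //]; case: f g fg => [f] [g] /= fg; congr Pser; exact/funext.
Qed.

Definition ps0 := Pser (fun=> 0).
Definition ps1 := Pser (fun m => (m == 0%MM)%:R).
Definition psopp f := Pser (fun m => - pscoef f m).
Definition psadd f g := Pser (fun m => pscoef f m + pscoef g m).
Definition psscale a f := Pser (fun m => a * pscoef f m).
Definition psmul f g := Pser (fun m =>
  \sum_(p : 'X_{1..n < (mdeg m).+1, (mdeg m).+1} | m == (p.1 + p.2)%MM)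
    pscoef f p.1 * pscoef g p.2).

Lemma psaddA : associative psadd.
Proof. by move=> f g h; apply/pserP => m; exact: addrA. Qed.
Lemma psaddC : commutative psadd.
Proof. by move=> f g; apply/pserP => m; exact: addrC. Qed.
Lemma psadd0 : left_id ps0 psadd.
Proof. by move=> f; apply/pserP => m; exact: add0r. Qed.
Lemma psaddN : left_inverse ps0 psopp psadd.
Proof. by move=> f; apply/pserP => m; exact: addNr. Qed.

HB.instance Definition _ := GRing.isZmodule.Build pser psaddA psaddC psadd0 psaddN.

Definition pstrunc d f : {mpoly k[n]} :=
  \sum_(m : 'X_{1..n < d}) pscoef f m *: 'X_[m].

Lemma pstruncE d f m : (mdeg m < d)%N -> (pstrunc d f)@_m = pscoef f m.
Proof.
move=> md; rewrite -[m]/(bmnm (BMultinom md)).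
exact: (mcoeff_mpoly (fun m => pscoef f m)).
Qed.

Lemma psmulE d f g m : (mdeg m < d)%N ->
  pscoef (psmul f g) m = (pstrunc d f * pstrunc d g)@_m.
Proof.
move=> md; rewrite mcoeffM; apply: eq_bigr => p _.
by rewrite !pstruncE //; apply: leq_trans md; exact: bmdeg.
Qed.

Lemma mcoeffM_eq (p p' r r' : {mpoly k[n]}) m :
  (forall m', (mdeg m' <= mdeg m)%N -> p@_m' = p'@_m') ->
  (forall m', (mdeg m' <= mdeg m)%N -> r@_m' = r'@_m') ->
  (p * r)@_m = (p' * r')@_m.
Proof.
move=> pE rE; rewrite !mcoeffM; apply: eq_bigr => x _.
by rewrite pE ?rE // -ltnS bmdeg.
Qed.

Lemma pstruncM d f g m : (mdeg m < d)%N ->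
  (pstrunc d (psmul f g))@_m = (pstrunc d f * pstrunc d g)@_m.
Proof. by move=> md; rewrite pstruncE // (psmulE _ _ md). Qed.

Lemma psmulA : associative psmul.
Proof.
move=> f g h; apply/pserP => m; rewrite !(@psmulE (mdeg m).+1) //.
transitivity (pstrunc (mdeg m).+1 f *
  (pstrunc (mdeg m).+1 g * pstrunc (mdeg m).+1 h))@_m.
  by apply: mcoeffM_eq => m' m'm //; rewrite pstruncM.
by rewrite mulrA; apply: mcoeffM_eq => m' m'm //; rewrite pstruncM.
Qed.

Lemma psmulC : commutative psmul.
Proof.
by move=> f g; apply/pserP => m; rewrite !(@psmulE (mdeg m).+1) // mulrC.
Qed.

Lemma psmul1 : left_id ps1 psmul.
Proof.
move=> f; apply/pserP => m; rewrite (@psmulE (mdeg m).+1) //.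
transitivity (1 * pstrunc (mdeg m).+1 f)@_m; last by rewrite mul1r pstruncE.
by apply: mcoeffM_eq => m' m'm //; rewrite pstruncE // mcoeff1.
Qed.

Lemma psmulDl : left_distributive psmul +%R.
Proof.
move=> f g h; apply/pserP => m.
rewrite -[RHS]/(pscoef (psmul f h) m + pscoef (psmul g h) m).
rewrite !(@psmulE (mdeg m).+1) // -mcoeffD -mulrDl.
by apply: mcoeffM_eq => m' m'm //; rewrite mcoeffD !pstruncE.
Qed.

Lemma ps1_neq0 : ps1 != 0.
Proof.
apply/eqP => /pserP /(_ 0%MM) /= /eqP.
by rewrite eqxx; apply/negP; exact: oner_neq0.
Qed.

HB.instance Definition _ :=
  GRing.Zmodule_isComNzRing.Build pser psmulA psmulC psmul1 psmulDl ps1_neq0.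

Lemma psscaleA a b f : psscale a (psscale b f) = psscale (a * b) f.
Proof. by apply/pserP => m; exact: mulrA. Qed.
Lemma psscale1 : left_id 1 psscale.
Proof. by move=> f; apply/pserP => m; exact: mul1r. Qed.
Lemma psscaleDr : right_distributive psscale +%R.
Proof. by move=> a f g; apply/pserP => m; exact: mulrDr. Qed.
Lemma psscaleDl f : {morph psscale^~ f : a b / a + b}.
Proof. by move=> a b; apply/pserP => m; exact: mulrDl. Qed.

HB.instance Definition _ := GRing.Zmodule_isLmodule.Build k pser
  psscaleA psscale1 psscaleDr psscaleDl.

Lemma psscaleAl (a : k) (f g : pser) : a *: (f * g) = a *: f * g.
Proof.
apply/pserP => m /=; rewrite mulr_sumr; apply: eq_bigr => p _.
by rewrite mulrA.
Qed.

HB.instance Definition _ := GRing.Lmodule_isLalgebra.Build k pser psscaleAl.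

Lemma psscaleAr (a : k) (f g : pser) : a *: (f * g) = f * (a *: g).
Proof. by rewrite mulrC psscaleAl mulrC. Qed.

HB.instance Definition _ := GRing.Lalgebra_isAlgebra.Build k pser psscaleAr.

End PowerSeries.

Section LinearSubstitution.
Variables (n : nat) (k : comNzRingType) (g : 'M[k]_n).

Definition linforms : n.-tuple {mpoly k[n]} :=
  [tuple \sum_(j < n) g j i *: 'X_j | i < n].

(* f(x_0, ..., x_(n-1)) |-> f(g x_0, ..., g x_(n-1)), where GL_n acts on the    *)
(* span of the variables as on column vectors: g x_i = \sum_j g_(j,i) x_j.      *)
(* As the g x_i are homogeneous of degree 1, only the terms of f of degree      *)
(* mdeg m contribute to the coefficient of x^m.                                 *)
Definition linsub (f : pser n k) : pser n k :=
  Pser (fun m => (pstrunc (mdeg m).+1 f \mPo linforms)@_m).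

Lemma linforms_homog (m : 'X_{1..n}) :
  'X_[m] \mPo linforms \is (mdeg m).-homog.
Proof.
rewrite comp_mpolyX mdegE.
elim/big_ind2: _ => [||i _]; first exact: dhomog1.
  by move=> ? ? ? ? ? ?; exact: dhomogM.
rewrite tnth_mktuple.
suff h : \sum_(j < n) g j i *: 'X_j \is 1.-homog.
  by have := dhomogMn (m i) h; rewrite mul1n.
apply: rpred_sum => j _; apply: rpredZ.
by apply/dhomogP => m'; rewrite msuppX inE => /eqP ->; exact: mdeg1.
Qed.

Lemma mcoeff_linforms_eq (p p' : {mpoly k[n]}) m :
  (forall m', (mdeg m' <= mdeg m)%N -> p@_m' = p'@_m') ->
  (p \mPo linforms)@_m = (p' \mPo linforms)@_m.
Proof.
move=> pE; apply/eqP; rewrite -subr_eq0 -mcoeffB -linearB /=; apply/eqP.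
rewrite comp_mpolyEX raddf_sum /= big1 // => m' _.
rewrite mcoeffZ; have [le|lt] := leqP (mdeg m') (mdeg m).
  by rewrite mcoeffB pE // subrr mul0r.
rewrite (dhomog_nemf_coeff (linforms_homog m')) ?mulr0 //.
by rewrite neq_ltn lt.
Qed.

Lemma linsubE d f m : (mdeg m < d)%N ->
  pscoef (linsub f) m = (pstrunc d f \mPo linforms)@_m.
Proof.
move=> md; apply: mcoeff_linforms_eq => m' m'm.
by rewrite !pstruncE //; apply: leq_ltn_trans md.
Qed.

Lemma linsub_linear : linear linsub.
Proof.
move=> a f h; apply/pserP => m; rewrite /= -mcoeffZ -mcoeffD -!linearP /=.
apply: mcoeff_linforms_eq => m' m'm.
by rewrite mcoeffD mcoeffZ !pstruncE.
Qed.

HB.instance Definition _ := GRing.isLinear.Build k (pser n k) (pser n k) *:%R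
  linsub linsub_linear.

Lemma linsub_monoid_morphism : monoid_morphism linsub.
Proof.
split=> [|f h]; apply/pserP => m.
  rewrite /= -(mcoeff1 k m) -(comp_mpoly1 linforms).
  by apply: mcoeff_linforms_eq => m' m'm; rewrite pstruncE // mcoeff1.
rewrite [RHS](@psmulE _ _ (mdeg m).+1) //.
transitivity ((pstrunc (mdeg m).+1 f \mPo linforms) *
  (pstrunc (mdeg m).+1 h \mPo linforms))@_m.
  rewrite -rmorphM; apply: mcoeff_linforms_eq => m' m'm.
  by rewrite pstruncM.
by apply: mcoeffM_eq => m' m'm; rewrite pstruncE //; exact/esym/linsubE.
Qed.

HB.instance Definition _ := GRing.isMonoidMorphism.Build (pser n k) (pser n k)
  linsub linsub_monoid_morphism.

End LinearSubstitution.

Section Invariants.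
Variables (n : nat) (k : comNzRingType) (G : {fset 'M[k]_n}).

Definition invariant_series : {pred pser n k} :=
  [pred f : pser n k | `[< forall g, g \in G -> linsub g f = f >] ].

Lemma invariant_series_subring : subring_closed invariant_series.
Proof.
split=> [|f h|f h]; rewrite !inE; first by apply/asboolP => g _; rewrite rmorph1.
  move=> /asboolP fP /asboolP hP; apply/asboolP => g gG.
  by rewrite linearB /= fP // hP.
move=> /asboolP fP /asboolP hP; apply/asboolP => g gG.
by rewrite rmorphM /= fP // hP.
Qed.

HB.instance Definition _ := GRing.isSubringClosed.Build (pser n k)
  invariant_series invariant_series_subring.

Record invring := Invring {
  invring_val :> pser n k;
  invring_valP : invring_val \in invariant_series }.

HB.instance Definition _ := [isSub for invring_val].
HB.instance Definition _ := [Choice of invring by <:].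
HB.instance Definition _ := [SubChoice_isSubComNzRing of invring by <:].

(* k-linear left actions of G on W; as for mx_representation, the values of an *)
(* action outside G are irrelevant                                             *)
Record gaction (W : lmodType k) := GAction {
  gact :> 'M[k]_n -> {linear W -> W};
  gact1 : gact 1%:M =1 id;
  gactM : {in G &, forall g h, gact (g *m h) =1 gact g \o gact h} }.

Section SymAction.
Variables (q : nat) (W : lmodType k) (a : gaction W).

Definition sympow_act (g : 'M[k]_n) : {linear sympow q W -> sympow q W} :=
  sympow_map (a g).

Lemma sympow_act1 : sympow_act 1%:M =1 id.
Proof.
exact/sympow_map_id/gact1.
Qed.

Lemma sympow_actM :
  {in G &, forall g h, sympow_act (g *m h) =1 sympow_act g \o sympow_act h}.
Proof.
by move=> g h gG hG; exact/sympow_map_comp/gactM.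
Qed.

Definition sympow_gaction : gaction (sympow q W) :=
  GAction sympow_act1 sympow_actM.

End SymAction.

Section InvariantModule.
Variables (W : lmodType k) (a : gaction W).

Local Notation SW := (tensor (pser n k) W).

Definition diag_act (g : 'M[k]_n) : SW -> SW := tensor_map (linsub g) (a g).

HB.instance Definition _ g := GRing.Linear.on (diag_act g).

Lemma diag_act0 g : diag_act g 0 = 0.
Proof. exact: linear0. Qed.

Lemma diag_actD g x y : diag_act g (x + y) = diag_act g x + diag_act g y.
Proof. exact: linearD. Qed.

Lemma diag_actE g f w : diag_act g (tens f w) = tens (linsub g f) (a g w).
Proof. exact: tensor_mapE. Qed.

Definition psmull (s f : pser n k) : pser n k := s * f.

Lemma psmull_linear s : linear (psmull s).
Proof. by move=> b f h; rewrite /psmull mulrDr scalerAr. Qed.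

HB.instance Definition _ s := GRing.isLinear.Build k (pser n k) (pser n k) *:%R
  (psmull s) (psmull_linear s).

(* the S-module structure of S (x)_k W *)
Definition tens_scale (s : pser n k) : SW -> SW := tensor_map (psmull s) idfun.

HB.instance Definition _ s := GRing.Linear.on (tens_scale s).

Lemma tens_scale0 s : tens_scale s 0 = 0.
Proof. exact: linear0. Qed.

Lemma tens_scaleDr s x y : tens_scale s (x + y) = tens_scale s x + tens_scale s y.
Proof. exact: linearD. Qed.

Lemma tens_scaleE s f w : tens_scale s (tens f w) = tens (s * f) w.
Proof. exact: tensor_mapE. Qed.

Lemma tens_scaleA s t x : tens_scale s (tens_scale t x) = tens_scale (s * t) x.
Proof.
elim/tensor_ind: x => [|f w x IH]; first by rewrite ?diag_act0 !tens_scale0 ?diag_act0.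
by rewrite ?diag_actD !tens_scaleDr ?diag_actD IH !tens_scaleE mulrA.
Qed.

Lemma tens_scale1 x : tens_scale 1 x = x.
Proof.
elim/tensor_ind: x => [|f w x IH]; first by rewrite tens_scale0.
by rewrite tens_scaleDr IH tens_scaleE mul1r.
Qed.

Lemma tens_scaleDl s t x : tens_scale (s + t) x = tens_scale s x + tens_scale t x.
Proof.
elim/tensor_ind: x => [|f w x IH]; first by rewrite !linear0 addr0.
rewrite ?diag_actD !tens_scaleDr ?diag_actD IH !tens_scaleE mulrDl -[s * f]scale1r tensPl !scale1r.
exact: addrACA.
Qed.

Lemma diag_act_scale g s x :
  diag_act g (tens_scale s x) = tens_scale (linsub g s) (diag_act g x).
Proof.
elim/tensor_ind: x => [|f w x IH]; first by rewrite ?diag_act0 !tens_scale0 ?diag_act0.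
by rewrite ?diag_actD !tens_scaleDr ?diag_actD IH !(tens_scaleE, diag_actE) rmorphM.
Qed.

Definition invariant_tens : {pred SW} :=
  [pred x : SW | `[< forall g, g \in G -> diag_act g x = x >] ].

Lemma invariant_tens_zmod : zmod_closed invariant_tens.
Proof.
split=> [|x y]; rewrite !inE; first by apply/asboolP => g _; rewrite linear0.
move=> /asboolP xP /asboolP yP; apply/asboolP => g gG.
by rewrite -scaleN1r addrC [LHS]linearP /= xP // yP.
Qed.

HB.instance Definition _ := GRing.isZmodClosed.Build SW invariant_tens
  invariant_tens_zmod.

(* (S (x)_k W)^G as a module over R = S^G *)
Record invmod := Invmod {
  invmod_val :> SW;
  invmod_valP : invmod_val \in invariant_tens }.

HB.instance Definition _ := [isSub for invmod_val].
HB.instance Definition _ := [Choice of invmod by <:].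
HB.instance Definition _ := [SubChoice_isSubZmodule of invmod by <:].

Lemma invmod_scale_subproof (r : invring) (x : invmod) :
  tens_scale r x \in invariant_tens.
Proof.
rewrite inE; apply/asboolP => g gG; rewrite diag_act_scale.
have := invmod_valP x; rewrite inE => /asboolP ->//.
by have := invring_valP r; rewrite inE => /asboolP ->.
Qed.

Definition invmod_scale r x := Invmod (invmod_scale_subproof r x).

Lemma invmod_scaleA r s x :
  invmod_scale r (invmod_scale s x) = invmod_scale (r * s) x.
Proof. by apply/val_inj; exact: tens_scaleA. Qed.

Lemma invmod_scale1 : left_id 1 invmod_scale.
Proof. by move=> x; apply/val_inj; exact: tens_scale1. Qed.

Lemma invmod_scaleDr : right_distributive invmod_scale +%R.
Proof. by move=> r x y; apply/val_inj; exact: tens_scaleDr. Qed.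

Lemma invmod_scaleDl x : {morph invmod_scale^~ x : r s / r + s}.
Proof. by move=> r s; apply/val_inj; exact: tens_scaleDl. Qed.

HB.instance Definition _ := GRing.Zmodule_isLmodule.Build invring invmod
  invmod_scaleA invmod_scale1 invmod_scaleDr invmod_scaleDl.

End InvariantModule.

End Invariants.

Section SmallSubgroups.
Variables (n : nat) (k : fieldType).

Definition GL_subgroup (G : {fset 'M[k]_n}) : Prop :=
  [/\ 1%:M \in G, {in G, forall g, g \in unitmx},
      {in G &, forall g h, g *m h \in G} & {in G, forall g, invmx g \in G}].

(* the subspace fixed by g has codimension 1 *)
Definition pseudo_reflection (g : 'M[k]_n) : bool := \rank (g - 1%:M) == 1%N.

Definition small (G : {fset 'M[k]_n}) : Prop :=
  {in G, forall g, ~~ pseudo_reflection g}.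

End SmallSubgroups.

(* Main.v *)
(* Since [G] is small, [g - 1] is invertible on the linear forms for every      *)
(* [g <> 1] in [G]. Expanding a product of elements [g l_g (x) 1 - 1 (x) l_g]    *)
(* with [g l_g - l_g = u] produces pairs [(x_i, y_i)] with                       *)
(* [\sum_i x_i h(y_i) = c] for [h = 1] and [0] for the other [h] in [G], where   *)
(* [c = u ^ (|G| - 1)]; likewise for [d = v ^ (|G| - 1)]. Hence                  *)
(* [c z = \sum_i x_i tr(y_i z)] for [z] in any [S (x) W]: up to the coprime      *)
(* elements [c] and [d], [S (x) W] is generated by its invariants.               *)
(*                                                                              *)
(* Put [T = Sym^q_R M] and [N = (S (x) Sym^q V)^G]. Every [R]-linear form [la]   *)
(* on [T] extends uniquely to an [S]-linear form [ext la] on [S (x) Sym^q V]: a  *)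
(* nonzero multiple of [la] extends because multiplication by some [r] in [R]    *)
(* factors [M] through a free module, and coprimality of [c] and [d] allows to   *)
(* divide the extension by [r ^ q]. By uniqueness [ext la] is equivariant, so    *)
(* [n |-> (la |-> ext la n)] maps [N] to the bidual of [T]. It is injective by   *)
(* nondegeneracy of the trace of [S] over [R], and surjective because            *)
(* [Hom_R(S, R)] is generated by that trace.                                     *)

Require Import Defs.
From HB Require Import structures.
From mathcomp Require Import all_boot all_order all_algebra perm.
From mathcomp Require Import finmap boolp.
From mathcomp Require Import freeg mpoly.

Set Implicit Arguments.
Unset Strict Implicit.
Unset Printing Implicit Defensive.

Import GRing.Theory.

Local Open Scope ring_scope.

(** * Power series and linear substitutions *)

(** Geometrically, smallness makes [G] act freely away from the closed point of [Spec S]. There [S]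
    is etale over [R], and multiplication from the symmetric power of the invariants to the
    invariants of the symmetric power is an isomorphism; as its target is reflexive, that target is
    the reflexive hull of the source. The free locus enters only through two identities, one for
    each variable: [exists_galois_pairs] supplies them, [inv_mul_span] deduces generation by
    invariants up to [c ^+ q], [exists_form_extension] extends linear forms, [ser_trace_repr]
    describes [Hom_R(S, R)], and [to_bidual_inj] with [to_bidual_surj] compare [N] with the
    bidual. *)

Section MonomialSeries.
Variables (n : nat) (k : comNzRingType).
Local Notation S := (pser n k).

Definition pmon (m : 'X_{1..n}) : S := Pser (fun m' => (m == m')%:R).

Lemma pstrunc_pmon m m' d : (mdeg m' < d)%N ->
  (pstrunc d (pmon m))@_m' = ('X_[m] : {mpoly k[n]})@_m'.
Proof. by move=> m'd; rewrite pstruncE // mcoeffX. Qed.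

Lemma pscoef_pmonM m f m' : pscoef (pmon m * f) (m + m')%MM = pscoef f m'.
Proof.
rewrite [LHS](@psmulE _ _ (mdeg (m + m')).+1) //.
rewrite (@mcoeffM_eq _ _ _ 'X_[m] _ (pstrunc (mdeg (m + m')).+1 f)) //.
  by rewrite mulrC mcoeffMX pstruncE // mdegD ltnS leq_addl.
by move=> x xm; rewrite pstrunc_pmon.
Qed.

Lemma pscoef_pmonM0 m f m' : ~~ (m <= m')%MM -> pscoef (pmon m * f) m' = 0.
Proof.
move=> mm'; apply: big1 => p /eqP m'E /=; rewrite (_ : (m == _) = false) ?mul0r //.
by apply/eqP => mE; move: mm'; rewrite m'E mE lem_addr.
Qed.

Lemma pmonD m m' : pmon (m + m')%MM = pmon m * pmon m'.
Proof.
apply/pserP => x; have [mx|mx] := boolP (m <= x)%MM.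
  have [x' ->] : exists x', x = (m + x')%MM.
    by exists (x - m)%MM; rewrite addmC submK.
  by rewrite pscoef_pmonM /= eqm_add2l.
rewrite pscoef_pmonM0 //= (_ : (_ == _) = false) //.
by apply/eqP => xE; move: mx; rewrite -xE lem_addr.
Qed.

Lemma pmon_lreg m : GRing.lreg (pmon m).
Proof.
move=> f h /pserP fh; apply/pserP => m'.
by have := fh (m + m')%MM; rewrite !pscoef_pmonM.
Qed.

Lemma pmonX m d : pmon m ^+ d = pmon (m *+ d)%MM.
Proof.
elim: d => [|d IH]; last by rewrite exprS IH -pmonD mulmS.
by apply/pserP => m'; rewrite expr0 mulm0n /= eq_sym.
Qed.

(** Multiplication by a power of [x_i] shifts exponents without changing the exponent of [x_j]. So
    the coefficients of [f] at exponents not divisible by [x_j ^ b] reappear as coefficients of a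
    multiple of [x_j ^ b], and vanish. *)
Lemma pmon_coprime i j a b (f h : S) : i != j ->
  pmon U_(i) ^+ a * f = pmon U_(j) ^+ b * h ->
  exists f', f = pmon U_(j) ^+ b * f'.
Proof.
move=> ij; rewrite !pmonX => /pserP E.
exists (Pser (fun m => pscoef f (U_(j) *+ b + m)%MM)); apply/pserP => m.
have [jm|jm] := boolP (U_(j) *+ b <= m)%MM.
  have [m' ->] : exists m', m = (U_(j) *+ b + m')%MM.
    by exists (m - U_(j) *+ b)%MM; rewrite addmC submK.
  by rewrite pscoef_pmonM.
rewrite (pscoef_pmonM0 _ jm) -(pscoef_pmonM (U_(i) *+ a)) E pscoef_pmonM0 //.
apply: contra jm => /mnm_lepP le; apply/mnm_lepP => l.
have := le l; rewrite mnmDE !mulmnE !mnm1E.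
by have [<-|] := eqVneq j l; rewrite ?mul0n // (negPf ij).
Qed.

End MonomialSeries.

Section LinsubTheory.
Variables (n : nat) (k : comNzRingType).
Implicit Types g h : 'M[k]_n.

Lemma linsub_pmon g (i : 'I_n) :
  linsub g (pmon k U_(i)) = \sum_(j < n) g j i *: pmon k U_(j).
Proof.
apply/pserP => m; rewrite /= (@mcoeff_linforms_eq _ _ _ _ 'X_i); last first.
  by move=> m' m'm; rewrite pstrunc_pmon.
rewrite comp_mpolyXU -tnth_nth tnth_mktuple.
have psum (I : Type) (r : seq I) (F : I -> pser n k) :
    pscoef (\sum_(j <- r) F j) m = \sum_(j <- r) pscoef (F j) m.
  by elim/big_rec2: _ => // j y1 y2 _ <-.
rewrite psum raddf_sum /=; apply: eq_bigr => j _.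
by rewrite mcoeffZ mcoeffX.
Qed.

Lemma linforms_comp g h (p : {mpoly k[n]}) :
  p \mPo linforms (g *m h) = (p \mPo linforms h) \mPo linforms g.
Proof.
rewrite (comp_mpolyEX p (linforms (g *m h))) (comp_mpolyEX p (linforms h)).
rewrite !raddf_sum /=.
apply: eq_bigr => m _; rewrite !comp_mpolyZ !comp_mpolyX rmorph_prod /=.
congr (_ *: _); apply: eq_bigr => i _; rewrite rmorphXn /=; congr (_ ^+ _).
rewrite !tnth_mktuple raddf_sum /= (eq_bigr (fun j =>
  \sum_(l < n) (h l i * g j l) *: ('X_j : {mpoly k[n]}))); last first.
  by move=> j _; rewrite mxE scaler_suml; apply: eq_bigr => l _; rewrite mulrC.
rewrite exchange_big /=; apply: eq_bigr => l _.
rewrite comp_mpolyZ comp_mpolyXU -tnth_nth tnth_mktuple scaler_sumr.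
by apply: eq_bigr => j _; rewrite scalerA.
Qed.

Lemma linsubM g h f : linsub (g *m h) f = linsub g (linsub h f).
Proof.
apply/pserP => m; rewrite /= linforms_comp.
by apply: mcoeff_linforms_eq => m' m'm; rewrite [RHS]pstruncE // -(linsubE h f).
Qed.

Lemma linsub1 (f : pser n k) : linsub 1%:M f = f.
Proof.
apply/pserP => m; rewrite /= (_ : linforms _ = [tuple 'X_i | i < n]).
  by rewrite comp_mpoly_id pstruncE.
apply: eq_from_tnth => i; rewrite !tnth_mktuple (bigD1 i) //= mxE eqxx scale1r.
by rewrite big1 ?addr0 // => j ji; rewrite mxE (negPf ji) scale0r.
Qed.

End LinsubTheory.

(** * Galois pairs and traces of power series *)

Section GaloisPairs.
Variables (n : nat) (k : fieldType) (G : {fset 'M[k]_n}).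
Local Notation S := (pser n k).
Local Notation R := (invring G).

Definition linform (v : 'cV[k]_n) : S := \sum_(j < n) v j 0 *: pmon k U_(j).

Lemma linsub_linform g v : linsub g (linform v) = linform (g *m v).
Proof.
rewrite /linform raddf_sum /= (eq_bigr (fun j => \sum_(l < n)
  (g l j * v j 0) *: pmon k U_(l))); last first.
  move=> j _; rewrite linearZ /= linsub_pmon scaler_sumr.
  by apply: eq_bigr => l _; rewrite scalerA mulrC.
rewrite exchange_big /=; apply: eq_bigr => l _.
by rewrite mxE scaler_suml.
Qed.

Lemma linformB v w : linform (v - w) = linform v - linform w.
Proof.
by rewrite -sumrB; apply: eq_bigr => j _; rewrite !mxE scalerBl.
Qed.

Lemma linform_delta i : linform (delta_mx i 0) = pmon k U_(i).
Proof.
rewrite /linform (bigD1 i) //= big1 ?addr0 => [|j ji].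
  by rewrite mxE !eqxx scale1r.
by rewrite mxE (negPf ji) scale0r.
Qed.

(* [xs] stands for the element [\sum p.1 (x) p.2] of [S (x) S]. *)
Definition galois_pairs (c : S) (xs : seq (S * S)) : Prop :=
  forall h, h \in G ->
  \sum_(p <- xs) p.1 * linsub h p.2 = if h == 1%:M then c else 0.

(* The pairs expand [\prod_(g in L) (g l_g (x) 1 - 1 (x) l_g)], where [l_g] is *)
(* the linear form with [g l_g - l_g = x_i].                                   *)
Lemma exists_separating_pairs i (L : seq 'M[k]_n) :
  (forall g, g \in L -> g - 1%:M \in unitmx) ->
  exists xs : seq (S * S),
    \sum_(p <- xs) p.1 * linsub 1%:M p.2 = pmon k U_(i) ^+ size L /\
    forall h, h \in L -> \sum_(p <- xs) p.1 * linsub h p.2 = 0.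
Proof.
elim: L => [_|g L IH uL].
  by exists [:: (1, 1)]; split=> //; rewrite big_seq1 mul1r rmorph1.
have [|xs [xs1 xsL]] := IH; first by move=> h hL; apply: uL; rewrite inE hL orbT.
have ug : g - 1%:M \in unitmx by apply: uL; rewrite inE eqxx.
pose l := linform (invmx (g - 1%:M) *m delta_mx i 0).
have lE : linsub g l - l = pmon k U_(i).
  rewrite linsub_linform -linformB -{2}[invmx _]mul1mx -mulmxA -mulmxBl.
  by rewrite mulmxA mulmxV // mul1mx linform_delta.
move: l lE => l lE.
pose xs' := [seq (p.1 * linsub g l, p.2) | p <- xs] ++ [seq (- p.1, p.2 * l) | p <- xs].
(* The new factor specializes at [h] to [g l - h l]: it is [x_i] for [h = 1] and vanishes for
   [h = g]. *)
have xsE h : \sum_(p <- xs') p.1 * linsub h p.2 =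
    (\sum_(p <- xs) p.1 * linsub h p.2) * (linsub g l - linsub h l).
  rewrite big_cat /= !big_map mulrBr; congr (_ + _).
    by rewrite mulr_suml; apply: eq_bigr => p _; exact: mulrAC.
  rewrite mulr_suml -[RHS]sumrN; apply: eq_bigr => p _.
  by rewrite rmorphM /= mulNr mulrA.
exists xs'; split=> [|h]; first by rewrite xsE xs1 linsub1 lE exprSr.
rewrite inE xsE => /orP[/eqP->|/xsL->]; first by rewrite subrr mulr0.
by rewrite mul0r.
Qed.

Lemma exists_galois_pairs i :
  1%:M \in G -> (forall g, g \in G -> g != 1%:M -> g - 1%:M \in unitmx) ->
  exists xs, galois_pairs (pmon k U_(i) ^+ size [seq g <- G | g != 1%:M]) xs.
Proof.
move=> G1 uG; have [|xs [xs1 xsL]] :=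
    @exists_separating_pairs i [seq g <- G | g != 1%:M].
  by move=> g; rewrite mem_filter => /andP[g1 gG]; exact: uG.
exists xs => h hG; case: ifPn => [/eqP-> //|h1].
by apply: xsL; rewrite mem_filter h1.
Qed.

Hypothesis G_subgroup : GL_subgroup G.

Lemma subgroup1 : 1%:M \in G. Proof. by case: G_subgroup. Qed.

Lemma subgroup_unit g : g \in G -> g \in unitmx.
Proof. by case: G_subgroup => _ uG _ _; exact: uG. Qed.

Lemma subgroupM g h : g \in G -> h \in G -> g *m h \in G.
Proof. by case: G_subgroup => _ _ mG _; exact: mG. Qed.

Lemma subgroupV g : g \in G -> invmx g \in G.
Proof. by case: G_subgroup => _ _ _; exact. Qed.

Lemma perm_subgroupM g : g \in G -> perm_eq [seq g *m h | h <- G] G.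
Proof.
move=> gG; have ug := subgroup_unit gG.
apply: uniq_perm; rewrite ?fset_uniq //.
  by rewrite map_inj_uniq ?fset_uniq //; apply: can_inj (mulKmx ug).
move=> h; apply/mapP/idP => [[h' h'G ->]|hG]; first exact: subgroupM.
by exists (invmx g *m h); rewrite ?mulKVmx //; apply: subgroupM => //; exact: subgroupV.
Qed.

Lemma big_subgroupM (T : Type) (x0 : T) (op : Monoid.com_law x0)
    (F : 'M[k]_n -> T) g : g \in G ->
  \big[op/x0]_(h <- G) F (g *m h) = \big[op/x0]_(h <- G) F h.
Proof.
move=> gG; rewrite -(big_map (mulmx g) xpredT F).
by apply: perm_big; exact: perm_subgroupM.
Qed.

Lemma linsubK g s : g \in G -> linsub (invmx g) (linsub g s) = s.
Proof.
by move=> gG; rewrite -linsubM mulVmx ?linsub1 //; exact: subgroup_unit.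
Qed.

Lemma linsubVK g s : g \in G -> linsub g (linsub (invmx g) s) = s.
Proof.
by move=> gG; rewrite -linsubM mulmxV ?linsub1 //; exact: subgroup_unit.
Qed.

Lemma invringE (r : R) g : g \in G -> linsub g (invring_val r) = r.
Proof. by move=> gG; have := invring_valP r; rewrite inE => /asboolP ->. Qed.

Lemma invring_valM (r t : R) : invring_val (r * t) = invring_val r * invring_val t.
Proof. by []. Qed.

Lemma invring_valD (r t : R) : invring_val (r + t) = invring_val r + invring_val t.
Proof. by []. Qed.

Lemma invring_inj : injective (@invring_val n k G).
Proof. exact: val_inj. Qed.

Lemma invring_valMn (r : R) m : invring_val (r *+ m) = invring_val r *+ m.
Proof. exact: (raddfMn (val : R -> S)). Qed.

Lemma invring_valX (r : R) m : invring_val (r ^+ m) = invring_val r ^+ m.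
Proof. exact: (rmorphXn (val : R -> S)). Qed.

Lemma invring_val_sum (I : Type) (L : seq I) (F : I -> R) :
  invring_val (\sum_(i <- L) F i) = \sum_(i <- L) invring_val (F i).
Proof. exact: (raddf_sum (val : R -> S)). Qed.

Lemma invring_val_prod (I : Type) (L : seq I) (F : I -> R) :
  invring_val (\prod_(i <- L) F i) = \prod_(i <- L) invring_val (F i).
Proof. exact: (rmorph_prod (val : R -> S)). Qed.

Definition ser_trace (s : S) : S := \sum_(h <- G) linsub h s.

Lemma ser_trace_inv s : ser_trace s \in invariant_series G.
Proof.
rewrite inE; apply/asboolP => g gG; rewrite raddf_sum /=.
rewrite -[RHS](big_subgroupM _ _ gG).
by apply: eq_bigr => h _; rewrite linsubM.
Qed.

Lemma ser_traceD s t : ser_trace (s + t) = ser_trace s + ser_trace t.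
Proof. by rewrite /ser_trace -big_split; apply: eq_bigr => h _; rewrite raddfD. Qed.

Lemma ser_trace_sum (I : Type) (r : seq I) (F : I -> S) :
  ser_trace (\sum_(i <- r) F i) = \sum_(i <- r) ser_trace (F i).
Proof.
by rewrite /ser_trace exchange_big /=; apply: eq_bigr => h _; rewrite raddf_sum.
Qed.

Lemma ser_traceM (r : R) s : ser_trace (invring_val r * s) = invring_val r * ser_trace s.
Proof.
rewrite mulr_sumr [LHS]big_seq [RHS]big_seq; apply: eq_bigr => h hG.
by rewrite rmorphM /= invringE.
Qed.

Lemma ser_trace_invring (r : R) : ser_trace (invring_val r) = #|` G|%:R * invring_val r.
Proof.
rewrite /ser_trace big_seq (eq_bigr (fun=> invring_val r)) => [|h hG].
  by rewrite -big_seq big_const_seq count_predT iter_addr_0 mulr_natl.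
exact: invringE.
Qed.

(** After exchanging the sums over [xs] and over [G], only the term of the identity survives. For
    regular [c], a series is thus determined by its traces against the second components of [xs]. *)
Lemma galois_ser_trace c xs s : galois_pairs c xs ->
  \sum_(p <- xs) p.1 * ser_trace (p.2 * s) = c * s.
Proof.
move=> xsP; rewrite (eq_bigr (fun p => \sum_(h <- G) p.1 * linsub h p.2 * linsub h s)).
  rewrite exchange_big big_seq /=.
  rewrite (eq_bigr (fun h => (if h == 1%:M then c else 0) * linsub h s)).
    rewrite -big_seq (bigD1_seq 1%:M) ?fset_uniq ?subgroup1 //= eqxx linsub1.
    by rewrite big1 ?addr0 // => h /negPf ->; rewrite mul0r.
  by move=> h hG; rewrite -mulr_suml xsP.
by move=> p _; rewrite mulr_sumr; apply: eq_bigr => h _; rewrite rmorphM /= mulrA.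
Qed.

Lemma linsub_lreg g c : g \in G -> GRing.lreg c -> GRing.lreg (linsub g c).
Proof.
move=> gG c_reg s t /(congr1 (linsub (invmx g))).
rewrite !rmorphM /= (linsubK c gG) => /c_reg.
exact: (can_inj (fun s => linsubVK s gG)).
Qed.

(** The witness is the norm of [c]: [c] is its factor at the identity, and all its factors are
    conjugates of [c], hence regular. *)
Lemma exists_invariant_multiple c : GRing.lreg c ->
  exists r : R, exists2 c', invring_val r = c' * c & GRing.lreg (invring_val r).
Proof.
move=> c_reg; pose N := \prod_(h <- G) linsub h c.
have NG : N \in invariant_series G.
  rewrite inE; apply/asboolP => g gG; rewrite rmorph_prod /=.
  rewrite -[RHS](big_subgroupM _ _ gG).
  by apply: eq_bigr => h _; rewrite linsubM.
exists (Invring NG), (\prod_(h <- G | h != 1%:M) linsub h c) => /=.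
  by rewrite /N (bigD1_seq 1%:M) ?fset_uniq ?subgroup1 //= linsub1 mulrC.
rewrite /N big_seq; apply: (big_ind (fun s => GRing.lreg s)).
- exact: lreg1.
- by move=> s t; exact: lregM.
- by move=> h hG; exact: linsub_lreg.
Qed.

End GaloisPairs.

(** In dimension two the rank of [g - 1] is 0, 1 or 2; the two hypotheses exclude 0 and 1. *)
Lemma nonreflection_unit (k : fieldType) (g : 'M[k]_2) :
  g != 1%:M -> ~~ pseudo_reflection g -> g - 1%:M \in unitmx.
Proof.
move=> g1; rewrite /pseudo_reflection -row_free_unit /row_free => r1.
have := rank_leq_row (g - 1%:M); have : \rank (g - 1%:M) != 0%N.
  by rewrite mxrank_eq0 subr_eq0.
by case: (\rank _) r1 => [|[|[|]]].
Qed.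

(** * Multilinear maps and symmetric powers *)

Section Multilinear.
Variables (A : comNzRingType) (q : nat).

Definition multilin (M X : lmodType A) (f : {ffun 'I_q -> M} -> X) : Prop :=
  forall x i a y z, f (fupd x i (a *: y + z)) = a *: f (fupd x i y) + f (fupd x i z).

Lemma fupd_id (M : lmodType A) (x : {ffun 'I_q -> M}) i : fupd x i (x i) = x.
Proof. by apply/ffunP => j; rewrite ffunE; case: eqP => [->|]. Qed.

Lemma multilin0 (M X : lmodType A) (f : {ffun 'I_q -> M} -> X) x i :
  multilin f -> f (fupd x i 0) = 0.
Proof.
move=> fP; have := fP x i (-1) 0 0.
by rewrite scaler0 addr0 scaleN1r addNr.
Qed.

Lemma multilin_eq (M X : lmodType A) (f g : {ffun 'I_q -> M} -> X) (E : M -> Prop) :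
  multilin f -> multilin g -> (forall y, y \in lspan E) ->
  (forall x : {ffun 'I_q -> M}, (forall j, E (x j)) -> f x = g x) -> f =1 g.
Proof.
move=> fP gP spanE fgE.
(* The first [m] arguments are arbitrary and the others lie in [E]; induction on [m] frees one
   argument at a time. *)
suff fg m (x : {ffun 'I_q -> M}) : (forall j : 'I_q, m <= j -> E (x j))%N -> f x = g x.
  by move=> x; apply: (fg q) => j; rewrite leqNgt ltn_ord.
elim: m x => [|m IH] x Ex; first by apply: fgE => j; exact: Ex.
have [mq|qm] := ltnP m q; last first.
  by apply: IH => j mj; have := leq_ltn_trans (leq_trans qm mj) (ltn_ord j); rewrite ltnn.
pose i := Ordinal mq; suff fgi y : f (fupd x i y) = g (fupd x i y).
  by rewrite -[x](fupd_id _ i).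
have := spanE y; rewrite inE => /asboolP.
move=> /(_ (fun y => f (fupd x i y) = g (fupd x i y))).
apply=> [|a y1 y2 E1 E2|y1 Ey1]; first by rewrite !multilin0.
  by rewrite fP gP E1 E2.
apply: IH => j mj; rewrite ffunE; case: eqP => // ji; apply: Ex.
by rewrite ltn_neqAle mj andbT; apply: contra_notN ji => /eqP mj'; exact/val_inj.
Qed.

Lemma prod_fupd (M : lmodType A) (T : comNzRingType) (F : 'I_q -> M -> T)
    (x : {ffun 'I_q -> M}) i y :
  \prod_j F j (fupd x i y j) = F i y * \prod_(j | j != i) F j (x j).
Proof.
rewrite (bigD1 i) //= ffunE eqxx; congr (_ * _).
by apply: eq_bigr => j /negPf ji; rewrite ffunE ji.
Qed.

Lemma multilin_prod (M X : lmodType A) (F : 'I_q -> M -> A) (v : X) :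
  (forall j a y z, F j (a *: y + z) = a * F j y + F j z) ->
  multilin (fun x => (\prod_j F j (x j)) *: v).
Proof.
move=> FP x i a y z.
by rewrite !(prod_fupd F) FP mulrDl scalerDl -mulrA -scalerA.
Qed.

Lemma multilin_prod_alg (M : lmodType A) (T : comAlgType A) (F : 'I_q -> M -> T) v :
  (forall j, linear (F j)) -> multilin (fun x => (\prod_j F j (x j)) * v).
Proof.
move=> FP x i a y z.
by rewrite !(prod_fupd F) FP !mulrDl -!scalerAl.
Qed.

(** Reindexing by [al |-> al o s] shows that sums of this shape are symmetric in their arguments, as
    [sympow_lift] requires. *)
Lemma sum_prod_perm (I : finType) (X : lmodType A) (P : pred {ffun 'I_q -> I})
    (C : {ffun 'I_q -> I} -> X) (c : 'I_q -> I -> A) (s : 'S_q) :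
  (forall al : {ffun 'I_q -> I}, P [ffun j => al (s j)] = P al) ->
  (forall al : {ffun 'I_q -> I}, C [ffun j => al (s j)] = C al) ->
  \sum_(al | P al) (\prod_j c (s j) (al j)) *: C al =
  \sum_(al | P al) (\prod_j c j (al j)) *: C al.
Proof.
move=> PP CP.
rewrite (reindex (fun al : {ffun 'I_q -> I} => [ffun j => al (s j)])) /=; last first.
  apply: onW_bij.
  exists (fun al : {ffun 'I_q -> I} => [ffun j => al (s^-1 j)%g]) => al;
    by apply/ffunP => j; rewrite !ffunE ?permK ?permKV.
apply: eq_big => // al _; rewrite CP; congr (_ *: _).
rewrite [RHS](reindex_inj (@perm_inj _ s)) /=.
by apply: eq_bigr => j _; rewrite !ffunE.
Qed.

Lemma multilin_sum (M X : lmodType A) (I : finType) (P : pred I)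
    (F : I -> {ffun 'I_q -> M} -> X) :
  (forall b, multilin (F b)) -> multilin (fun x => \sum_(b | P b) F b x).
Proof.
move=> FP x i a y z; rewrite scaler_sumr -big_split /=.
by apply: eq_bigr => b _; exact: FP.
Qed.

Lemma multilin_comp (M N X : lmodType A) (f : {ffun 'I_q -> N} -> X)
    (h : 'I_q -> M -> N) :
  (forall j, linear (h j)) -> multilin f ->
  multilin (fun x : {ffun 'I_q -> M} => f [ffun j => h j (x j)]).
Proof.
move=> hP fP x i a y z.
have E y' : [ffun j => h j (fupd x i y' j)] = fupd [ffun j => h j (x j)] i (h i y').
  by apply/ffunP => j; rewrite !ffunE; case: eqP => [->|].
by rewrite !E hP fP.
Qed.

Lemma multilin_expand (M X : lmodType A) (f : {ffun 'I_q -> M} -> X) (I : finType)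
    (c : 'I_q -> I -> A) (e : 'I_q -> I -> M) : multilin f ->
  f [ffun j => \sum_b c j b *: e j b] =
  \sum_(al : {ffun 'I_q -> I}) (\prod_j c j (al j)) *: f [ffun j => e j (al j)].
Proof.
(* Both sides are multilinear in the coefficient vectors [c j], seen in the free module [U]; so they
   need comparing only on the standard basis [d], where a single [al] contributes. *)
move=> fP; pose U := {ffun I -> A^o}.
pose d (b : I) : U := [ffun b' => (b == b')%:R].
have dE (y : U) : y = \sum_b (y b : A) *: d b.
  apply/ffunP => b; rewrite sum_ffunE (bigD1 b) //= !ffunE eqxx big1 => [|b' b'b].
    by rewrite -[RHS]/((y b : A) * 1 + 0) [RHS]addr0 mulr1.
  by rewrite !ffunE (negPf b'b) scaler0.
pose lhs (x : {ffun 'I_q -> U}) := f [ffun j => \sum_b (x j b : A) *: e j b].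
pose rhs (x : {ffun 'I_q -> U}) := \sum_(al : {ffun 'I_q -> I})
  (\prod_j (x j (al j) : A)) *: f [ffun j => e j (al j)].
suff E : lhs =1 rhs.
  have := E [ffun j => [ffun b => c j b]]; rewrite /lhs /rhs => E'.
  transitivity (f [ffun j => \sum_b ([ffun j' => [ffun b' => c j' b']] j b : A) *: e j b]).
    by congr f; apply/ffunP => j; rewrite !ffunE; apply: eq_bigr => b _; rewrite !ffunE.
  rewrite E'; apply: eq_bigr => al _; congr (_ *: _).
  by apply: eq_bigr => j _; rewrite !ffunE.
apply: (multilin_eq (E := fun y => exists b, y = d b)).
- apply: (multilin_comp (h := fun j (y : U) => \sum_b (y b : A) *: e j b)) => // j a y z.
  rewrite scaler_sumr -big_split /=; apply: eq_bigr => b _.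
  by rewrite !ffunE scalerDl scalerA.
- apply: multilin_sum => al.
  apply: (multilin_prod (F := fun j (y : U) => y (al j) : A)) => j a y z.
  by rewrite !ffunE.
- move=> y; rewrite (dE y); apply: rpred_sum => b _; apply: rpredZ.
  by apply: mem_lspan; exists b.
- move=> x /(_ _)/cid - /all_sig[ga gaE].
  rewrite /rhs (bigD1 (finfun ga)) //= [X in _ + X]big1 => [|al alga].
    rewrite addr0 big1 ?scale1r => [|j _]; last by rewrite gaE !ffunE eqxx.
    congr f; apply/ffunP => j; rewrite !ffunE gaE (bigD1 (ga j)) //= big1.
      by rewrite ffunE eqxx scale1r addr0.
    by move=> b bga; rewrite ffunE eq_sym (negPf bga) scale0r.
  have [j alj] : exists j, al j != ga j.
    apply/existsP; apply: contraNT alga => /existsPn al'; apply/eqP/ffunP => j.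
    by rewrite ffunE; apply/eqP; rewrite -[_ == _]negbK; exact: al'.
  by rewrite (bigD1 j) //= gaE ffunE eq_sym (negPf alj) mul0r scale0r.
Qed.

Lemma multilin_scale (M X : lmodType A) (f : {ffun 'I_q -> M} -> X) r
    (x : {ffun 'I_q -> M}) :
  multilin f -> f [ffun j => r *: x j] = r ^+ q *: f x.
Proof.
move=> fP; transitivity (f [ffun j => \sum_(b : unit) r *: x j]).
  by congr f; apply/ffunP => j; rewrite !ffunE big_const card_unit /= addr0.
rewrite (multilin_expand (fun _ _ => r) (fun j _ => x j)) //.
rewrite (bigD1 [ffun=> tt]) //= [X in _ + X]big1 ?addr0 => [|al]; last first.
  by move=> /negP[]; apply/eqP/ffunP => j; rewrite ffunE; case: (al j).
rewrite prodr_const card_ord; congr (_ *: f _).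
by apply/ffunP => j; rewrite ffunE.
Qed.

Lemma symprod_multilin (M : lmodType A) : multilin (@symprod A q M).
Proof. by move=> x i a y z; exact: symprodP. Qed.

Lemma sympow_lift (M X : lmodType A) (f : {ffun 'I_q -> M} -> X) :
  multilin f -> (forall (x : {ffun 'I_q -> M}) (s : 'S_q), f [ffun j => x (s j)] = f x) ->
  exists g : {linear sympow q M -> X}, forall x, g (symprod x) = f x.
Proof.
move=> fP fS.
have kills D : @sympow_rel A q M D -> fglift f D = 0.
  case=> [x i a y z|x s]; rewrite linearB ?linearP /= !liftU !scale1r.
    by rewrite fP scalerN -opprD subrr.
  by rewrite fS subrr.
pose g (t : sympow q M) : X := fglift f (repr t).
have gE D : g (quotmod_pi (@sympow_rel A q M) D) = fglift f D.
  exact: (quotmod_liftE kills).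
have gP : linear g.
  move=> a s t; rewrite -[s](@quotmod_reprK _ _ (@sympow_rel A q M)).
  rewrite -[t](@quotmod_reprK _ _ (@sympow_rel A q M)) -linearP !gE.
  by rewrite linearP.
pose gL : {linear sympow q M -> X} :=
  HB.pack g (GRing.isLinear.Build A (sympow q M) X *:%R g gP).
exists gL => x.
by rewrite /= gE liftU scale1r.
Qed.

End Multilinear.

(** * Generating families with linear coordinates *)

Section DualBasis.
Variables (A : comNzRingType) (W : lmodType A) (B : finType).

(* [e] generates [W], with coordinates [eps] depending linearly on the vector; *)
(* [e] need not be free                                                        *)
Definition dual_basis (e : B -> W) (eps : B -> {linear W -> A^o}) : Prop :=
  forall w, w = \sum_b eps b w *: e b.

End DualBasis.

Section SymDualBasis.
Variables (A : comNzRingType) (W : lmodType A) (B : finType) (q : nat).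
Variables (e : B -> W) (eps : B -> {linear W -> A^o}).
Hypothesis eE : dual_basis e eps.
Local Notation J := {ffun 'I_q -> B}.
Implicit Types (al be : J).

Definition perm_related (al be : J) : bool :=
  [exists s : 'S_q, [ffun j => al (s j)] == be].

(** A representative of the orbit of [al] under permutations. It is constant on orbits because
    [pick] depends only on the predicate; the default is never reached, as [al] is related to
    itself. *)
Definition perm_repr (al : J) : J := odflt al [pick be | perm_related al be].

Lemma perm_reprP al : exists s : 'S_q, perm_repr al = [ffun j => al (s j)].
Proof.
rewrite /perm_repr; case: pickP => [be /existsP[s /eqP <-]|_]; first by exists s.
by exists 1%g; apply/ffunP => j; rewrite ffunE perm1.
Qed.

Lemma perm_related_perm al (s : 'S_q) be :
  perm_related [ffun j => al (s j)] be = perm_related al be.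
Proof.
apply/existsP/existsP => -[t /eqP <-].
  by exists (t * s)%g; apply/eqP/ffunP => j; rewrite !ffunE permM.
exists (t * s^-1)%g; apply/eqP/ffunP => j.
by rewrite !ffunE permM permKV.
Qed.

Lemma perm_repr_perm al (s : 'S_q) : perm_repr [ffun j => al (s j)] = perm_repr al.
Proof.
rewrite /perm_repr (eq_pick (perm_related_perm al s)); case: pickP => // no.
have /existsP[] := no al; exists 1%g.
by apply/eqP/ffunP => j; rewrite ffunE perm1.
Qed.

Lemma symprod_perm_repr al :
  symprod [ffun j => e (perm_repr al j)] = symprod [ffun j => e (al j)].
Proof.
have [s ->] := perm_reprP al; rewrite -[RHS](symprod_perm _ s).
by congr symprod; apply/ffunP => j; rewrite !ffunE.
Qed.

(** The coordinate at [be] sums the products of coordinates over the whole orbit represented by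
    [be], which makes it symmetric without dividing by factorials. It is zero when [be] is not a
    chosen representative, so each monomial is counted once. *)
Lemma sympow_dual_basis : exists eps' : J -> {linear sympow q W -> A^o},
  dual_basis (fun al => symprod [ffun j => e (al j)]) eps'.
Proof.
pose f (be : J) (v : {ffun 'I_q -> W}) : A^o :=
  \sum_(al | perm_repr al == be) (\prod_j (eps (al j) (v j) : A)) *: (1 : A^o).
have fP be : multilin (f be).
  apply: multilin_sum => al.
  apply: (multilin_prod (F := fun j (w : W) => eps (al j) w : A)) => j a y z.
  by rewrite linearP.
have fS be (x : {ffun 'I_q -> W}) (s : 'S_q) : f be [ffun j => x (s j)] = f be x.
  transitivity (\sum_(al | perm_repr al == be)
      (\prod_j (eps (al j) (x (s j)) : A)) *: (1 : A^o)).
    by apply: eq_bigr => al _; congr (_ *: _); apply: eq_bigr => j _; rewrite ffunE.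
  apply: (sum_prod_perm (C := fun=> 1 : A^o) (fun j b => eps b (x j))) => // al.
  by rewrite perm_repr_perm.
have /all_sig[eps' eps'E] be := cid (sympow_lift (fP be) (fS be)).
exists eps'; elim/sympow_ind => [|a v t IH].
  by rewrite big1 // => be _; rewrite linear0 scale0r.
rewrite (eq_bigr (fun be => a *: (eps' be (symprod v) *:
    symprod [ffun j => e (be j)]) + eps' be t *: symprod [ffun j => e (be j)])).
  rewrite big_split -IH; congr (_ + _); rewrite -scaler_sumr; congr (_ *: _).
  have {1}-> : v = [ffun j => \sum_b eps b (v j) *: e b].
    by apply/ffunP => j; rewrite ffunE -eE.
  rewrite (multilin_expand (fun j b => eps b (v j)) (fun=> e) (symprod_multilin (M := W))).
  rewrite (partition_big perm_repr predT) //=; apply: eq_bigr => be _.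
  rewrite eps'E /f scaler_suml; apply: eq_bigr => al /eqP <-.
  by rewrite symprod_perm_repr; congr (_ *: _); exact/esym/mulr1.
by move=> be _; rewrite linearP scalerDl scalerA.
Qed.

End SymDualBasis.

Lemma vect_dual_basis (k : fieldType) (V : vectType k) :
  dual_basis (fun i : 'I_(\dim {:V}) => (vbasis {:V})`_i) (coord (vbasis {:V})).
Proof. by move=> v; apply: coord_vbasis; exact: memvf. Qed.

(** * Linear forms on scalar extensions *)

Section Forms.
Variables (A : comNzRingType) (M : lmodType A).

Definition is_form (f : M -> A) : Prop :=
  forall s y z, f (s *: y + z) = s * f y + f z.

Variables (f : M -> A) (fP : is_form f).

Lemma is_form0 : f 0 = 0.
Proof. by have := fP (-1) 0 0; rewrite scaler0 addr0 mulN1r addNr. Qed.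

Lemma is_formZ s y : f (s *: y) = s * f y.
Proof. by have := fP s y 0; rewrite is_form0 !addr0. Qed.

Lemma is_form_sum (I : Type) (r : seq I) (c : I -> A) (y : I -> M) :
  f (\sum_(i <- r) c i *: y i) = \sum_(i <- r) c i * f (y i).
Proof.
elim: r => [|i r IH]; first by rewrite !big_nil is_form0.
by rewrite !big_cons fP IH.
Qed.

End Forms.

Section DualForms.
Variables (A : comNzRingType) (M : lmodType A).
Implicit Types la : dual M.

Lemma dual_form la : is_form (la : M -> A).
Proof. by have := dual_linear la; rewrite inE => /asboolP. Qed.

Lemma form_linear_fun (f : M -> A) : is_form f -> (f : M -> A^o) \in @linear_fun A M.
Proof. by move=> fP; rewrite inE; apply/asboolP. Qed.

Definition form_dual (f : M -> A) (fP : is_form f) : dual M := Dual (form_linear_fun fP).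

Lemma form_dualE f (fP : is_form f) x : form_dual fP x = f x.
Proof. by []. Qed.

Lemma dual_ext la la' : (forall x, la x = la' x :> A) -> la = la'.
Proof. by move=> E; apply: val_inj; apply: funext. Qed.

Lemma dual_linE r la la' x : (r *: la + la') x = r * la x + la' x :> A.
Proof. by []. Qed.

Lemma dual_scaleE r la x : (r *: la) x = r * la x :> A.
Proof. by []. Qed.

Lemma dual_sumE (I : finType) (F : I -> dual M) x :
  (\sum_i F i) x = \sum_i F i x :> A.
Proof. by elim/big_rec2: _ => // i u v _ <-. Qed.

End DualForms.

Section ScalarExtension.
Variables (n : nat) (k : comNzRingType) (W : lmodType k).
Local Notation S := (pser n k).

(* [S (x)_k W], with its [S]-module structure instead of the [k]-module *)
(* structure of [tensor]                                                *)
Definition stens : Type := tensor S W.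
HB.instance Definition _ := GRing.Zmodule.on stens.
HB.instance Definition _ := GRing.Zmodule_isLmodule.Build S stens
  (@tens_scaleA n k W) (@tens_scale1 n k W) (@tens_scaleDr n k W)
  (fun x s t => @tens_scaleDl n k W s t x).

Definition st (s : S) (w : W) : stens := tens s w.

Lemma stens_scaleE s (x : stens) : s *: x = tens_scale s x :> tensor S W.
Proof. by []. Qed.

Lemma st_scale s t w : s *: st t w = st (s * t) w.
Proof. exact: tens_scaleE. Qed.

Lemma stPr s a w w' : st s (a *: w + w') = a%:A *: st s w + st s w'.
Proof.
by rewrite st_scale /st -scalerAl mul1r tensZl tensPr.
Qed.

Lemma stZr s a w : st s (a *: w) = a%:A *: st s w.
Proof.
have st0 : st s 0 = 0.
  by have := stPr s (-1) 0 0; rewrite scaler0 addr0 scaleN1r scaleNr scale1r addNr.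
by have := stPr s a w 0; rewrite st0 !addr0.
Qed.

Lemma stens_ind (P : stens -> Prop) :
  P 0 -> (forall s w t, P t -> P (s *: st 1 w + t)) -> forall t, P t.
Proof.
move=> P0 PD; apply: tensor_ind => // s w t Pt.
by have := PD s w t Pt; rewrite st_scale mulr1.
Qed.

Lemma form_lift (mu : W -> S) :
  (forall a w w', mu (a *: w + w') = a%:A * mu w + mu w') ->
  exists2 f : stens -> S, is_form f & forall s w, f (st s w) = s * mu w.
Proof.
move=> muP; pose b s w : S := s * mu w.
have bl w : linear (b^~ w) by move=> a s t; rewrite /b mulrDl scalerAl.
have br s : linear (b s).
  by move=> a w w'; rewrite /b muP mulrDr mulrCA -scalerAl mul1r.
exists (tensor_lift_ bl br) => [s y z|s w]; last exact: tensor_liftE.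
rewrite [LHS]linearD; congr (_ + _); elim/tensor_ind: y => [|t w y IH].
  by rewrite scaler0 !linear0 mulr0.
rewrite scalerDr [LHS]linearD IH [X in _ = s * X]linearD mulrDr; congr (_ + _).
by rewrite stens_scaleE tens_scaleE /= !tensor_liftE /b mulrA.
Qed.

End ScalarExtension.

Section Coordinates.
Variables (n : nat) (k : comNzRingType) (W : lmodType k) (B : finType).
Variables (e : B -> W) (eps : B -> {linear W -> k^o}).
Local Notation S := (pser n k).

(** The forms [cf b] are the base changes of the [eps b] from [k] to [S]. *)
Lemma exists_coordinates : dual_basis e eps ->
  exists cf : B -> stens n W -> S,
  [/\ forall b, is_form (cf b),
      forall z, z = \sum_b cf b z *: st 1 (e b)
    & forall b s w, cf b (st s w) = s * (eps b w : k)%:A].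
Proof.
move=> eE.
have lift b : exists f : stens n W -> S,
    is_form f /\ forall s w, f (st s w) = s * (eps b w : k)%:A.
  have [|f fP fE] := @form_lift n k W (fun w => (eps b w : k)%:A).
    move=> a w w'; rewrite linearP scalerDl; congr (_ + _).
    by rewrite -scalerAl mul1r scalerA.
  by exists f.
have /all_sig[cf cfP] b := cid (lift b); exists cf; split.
- by move=> b; case: (cfP b).
- elim/stens_ind => [|s w t IH].
    by rewrite big1 // => b _; have [cfb _] := cfP b; rewrite is_form0 // scale0r.
  rewrite {1}IH {1}(eE w).
  have -> : st (1 : S) (\sum_b (eps b w : k) *: e b) =
      \sum_b (eps b w : k)%:A *: st (1 : S) (e b).
    elim/big_rec2: _ => [|b y y' _ <-]; last exact: stPr.
    by rewrite -(scale0r 0) stZr !scale0r.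
  rewrite scaler_sumr -big_split; apply: eq_bigr => b _.
  by have [cfb cfs] := cfP b; rewrite /= cfb cfs mul1r scalerDl scalerA.
- by move=> b; case: (cfP b).
Qed.

End Coordinates.

(** * Traces of elements and of forms *)

Section Traces.
Variables (n : nat) (k : fieldType) (G : {fset 'M[k]_n}).
Hypothesis G_subgroup : GL_subgroup G.
Variables (W : lmodType k) (a : gaction G W).
Local Notation S := (pser n k).
Local Notation R := (invring G).
Local Notation SW := (stens n W).
Implicit Types (y z : SW) (s : S).

Definition dact (g : 'M[k]_n) (z : SW) : SW := diag_act a g z.

Lemma dactD g y z : dact g (y + z) = dact g y + dact g z.
Proof. exact: diag_actD. Qed.

Lemma dactZ g s z : dact g (s *: z) = linsub g s *: dact g z.
Proof. exact: diag_act_scale. Qed.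

Lemma dact_st g s w : dact g (st s w) = st (linsub g s) (a g w).
Proof. exact: diag_actE. Qed.

Lemma dact0 g : dact g 0 = 0.
Proof. exact: diag_act0. Qed.

Lemma dact_sum g (I : Type) (r : seq I) (F : I -> SW) :
  dact g (\sum_(i <- r) F i) = \sum_(i <- r) dact g (F i).
Proof. by elim/big_rec2: _ => [|i y1 y2 _ <-]; rewrite ?dact0 ?dactD. Qed.

Lemma dactM g h z : g \in G -> h \in G -> dact (g *m h) z = dact g (dact h z).
Proof.
move=> gG hG; elim/stens_ind: z => [|s w z IH]; first by rewrite !dact0.
rewrite !dactD IH !dactZ !dact_st !(rmorph1 (linsub _)) (linsubM g h s).
by rewrite gactM.
Qed.

Lemma dact1 z : dact 1%:M z = z.
Proof.
elim/stens_ind: z => [|s w z IH]; first by rewrite dact0.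
by rewrite dactD IH dactZ dact_st (linsub1 s) (linsub1 1) gact1.
Qed.

Lemma invmodE (m : invmod a) g : g \in G -> dact g (invmod_val m) = invmod_val m.
Proof. by move=> gG; have := invmod_valP m; rewrite inE => /asboolP /(_ g gG). Qed.

Lemma invmod_inj (x y : invmod a) : invmod_val x = invmod_val y :> SW -> x = y.
Proof. exact: val_inj. Qed.

Lemma invmod_val_lin r (x y : invmod a) :
  invmod_val (r *: x + y) = invring_val r *: (invmod_val x : SW) + invmod_val y :> SW.
Proof. by []. Qed.

Lemma invmod_val_sum (I : finType) (r : I -> R) (m : I -> invmod a) :
  invmod_val (\sum_i r i *: m i) =
  \sum_i invring_val (r i) *: (invmod_val (m i) : SW) :> SW.
Proof.
have vD (x y : invmod a) :
  invmod_val (x + y) = (invmod_val x : SW) + invmod_val y :> SW by [].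
by elim/big_rec2: _ => [//|i x y _ <-]; rewrite vD.
Qed.

Definition mod_trace z : SW := \sum_(h <- G) dact h z.

Lemma mod_trace_inv z : mod_trace z \in invariant_tens a.
Proof.
rewrite inE; apply/asboolP => g gG; rewrite -[LHS]/(dact g _) dact_sum.
rewrite -[RHS](big_subgroupM G_subgroup _ _ gG) big_seq [RHS]big_seq.
by apply: eq_bigr => h hG; rewrite dactM.
Qed.

Definition trace_elt z : invmod a := Invmod (mod_trace_inv z).

Lemma mod_trace_sum (I : Type) (r : seq I) (F : I -> SW) :
  mod_trace (\sum_(i <- r) F i) = \sum_(i <- r) mod_trace (F i).
Proof.
by rewrite /mod_trace exchange_big /=; apply: eq_bigr => h _; exact: dact_sum.
Qed.

Lemma mod_traceZ_inv s (m : invmod a) :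
  mod_trace (s *: (invmod_val m : SW)) = ser_trace G s *: (invmod_val m : SW).
Proof.
rewrite /mod_trace /ser_trace scaler_suml big_seq [RHS]big_seq.
by apply: eq_bigr => h hG; rewrite dactZ invmodE.
Qed.

(** The same cancellation as in [galois_ser_trace]; it writes [c *: z] as an [S]-combination of
    invariants. *)
Lemma galois_mod_trace c xs z : galois_pairs G c xs ->
  \sum_(p <- xs) p.1 *: mod_trace (p.2 *: z) = c *: z.
Proof.
move=> xsP.
rewrite (eq_bigr (fun p => \sum_(h <- G) (p.1 * linsub h p.2) *: dact h z)).
  rewrite exchange_big big_seq /=.
  rewrite (eq_bigr (fun h => (if h == 1%:M then c else 0) *: dact h z)).
    rewrite -big_seq (bigD1_seq 1%:M) ?fset_uniq ?subgroup1 //= eqxx dact1.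
    by rewrite big1 ?addr0 // => h /negPf ->; rewrite scale0r.
  by move=> h hG; rewrite -scaler_suml xsP.
by move=> p _; rewrite scaler_sumr; apply: eq_bigr => h _; rewrite dactZ scalerA.
Qed.

Lemma equivariant_mod_trace (f : SW -> S) z : is_form f ->
  (forall g y, g \in G -> f (dact g y) = linsub g (f y)) ->
  f (mod_trace z) = ser_trace G (f z).
Proof.
move=> fP fE; rewrite /mod_trace /ser_trace.
rewrite (eq_bigr (fun h => 1 *: dact h z)) => [|h _]; last by rewrite scale1r.
rewrite is_form_sum // big_seq [RHS]big_seq.
by apply: eq_bigr => h hG; rewrite mul1r fE.
Qed.

(** The sum of the [G]-conjugates of [f]. It stays [S]-linear, while on invariants it is the trace
    of [f] and so takes values in [R]. *)
Definition conj_form (f : SW -> S) z : S :=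
  \sum_(h <- G) linsub h (f (dact (invmx h) z)).

Lemma conj_form_form f : is_form f -> is_form (conj_form f).
Proof.
move=> fP s y z; rewrite /conj_form mulr_sumr -big_split big_seq [RHS]big_seq.
apply: eq_bigr => h hG.
by rewrite dactD dactZ fP rmorphD rmorphM /= (linsubVK G_subgroup _ hG).
Qed.

Lemma conj_form_inv f (m : invmod a) :
  conj_form f (invmod_val m) = ser_trace G (f (invmod_val m)).
Proof.
rewrite /conj_form big_seq [RHS]big_seq; apply: eq_bigr => h hG.
by rewrite invmodE ?(subgroupV G_subgroup).
Qed.

End Traces.

(** * Symmetric powers of modules of invariants *)

Section SymmetricProduct.
Variables (n : nat) (k : fieldType) (G : {fset 'M[k]_n}).
Hypothesis G_subgroup : GL_subgroup G.
Variables (V : lmodType k) (a : gaction G V) (q : nat).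
Local Notation S := (pser n k).
Local Notation R := (invring G).
Local Notation SV := (stens n V).
Local Notation SW := (stens n (sympow q V)).
Local Notation M := (invmod a).
Local Notation N := (invmod (sympow_gaction q a)).
Variables (B : finType) (e : B -> V) (eps : B -> {linear V -> k^o}).
Hypothesis eE : dual_basis e eps.
Variable cf : B -> SV -> S.
Hypothesis cf_form : forall b, is_form (cf b).
Hypothesis cfE : forall z, z = \sum_b cf b z *: st 1 (e b).
Hypothesis cf_st : forall b s w, cf b (st s w) = s * (eps b w : k)%:A.
Local Notation J := {ffun 'I_q -> B}.
Implicit Types (z : {ffun 'I_q -> SV}) (x : {ffun 'I_q -> M}).

(* the [S]-multilinear map sending the [st s_j v_j] to [st (\prod_j s_j) (v_1 ... v_q)] *)
Definition sym_mul z : SW :=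
  \sum_(al : J) (\prod_j cf (al j) (z j)) *: st 1 (symprod [ffun j => e (al j)]).

Lemma sym_mul_multilin : multilin sym_mul.
Proof.
apply: multilin_sum => al.
by apply: (multilin_prod (F := fun j (y : SV) => cf (al j) y)) => j s y z; exact: cf_form.
Qed.

Lemma sym_mul_st (v : {ffun 'I_q -> V}) :
  sym_mul [ffun j => st 1 (v j)] = st 1 (symprod v).
Proof.
have {2}-> : v = [ffun j => \sum_b (eps b (v j) : k) *: e b].
  by apply/ffunP => j; rewrite ffunE -eE.
rewrite (multilin_expand (fun j b => eps b (v j) : k) (fun=> e)
  (symprod_multilin (M := V))).
have st_sum (c : J -> k) (w : J -> sympow q V) :
    st (1 : S) (\sum_al c al *: w al) = \sum_al (c al)%:A *: st 1 (w al).
  elim/big_rec2: _ => [|al y y' _ <-]; last exact: stPr.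
  by rewrite -(scale0r 0) stZr !scale0r.
rewrite st_sum; apply: eq_bigr => al _; congr (_ *: _).
rewrite [RHS](rmorph_prod (in_alg S)) /=.
by apply: eq_bigr => j _; rewrite ffunE cf_st mul1r.
Qed.

(** The family [e] need not be stable under [g]. After expanding the [z j] in [e], the terms are
    therefore handled by [sym_mul_st], which applies to arbitrary vectors, in particular to the
    [g e_b]. *)
Lemma dact_sym_mul g z : g \in G ->
  dact (sympow_gaction q a) g (sym_mul z) = sym_mul [ffun j => dact a g (z j)].
Proof.
move=> gG; transitivity (sym_mul [ffun j => \sum_b
    linsub g (cf b (z j)) *: st 1 (a g (e b))]); last first.
  congr sym_mul; apply/ffunP => j; rewrite !ffunE {2}(cfE (z j)) dact_sum.
  by apply: eq_bigr => b _; rewrite dactZ dact_st (rmorph1 (linsub g)).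
rewrite (multilin_expand _ _ sym_mul_multilin) dact_sum; apply: eq_bigr => al _.
rewrite dactZ dact_st (rmorph1 (linsub g)) rmorph_prod; congr (_ *: _).
transitivity (sym_mul [ffun j => st 1 ([ffun j => a g (e (al j))] j)]); last first.
  by congr sym_mul; apply/ffunP => j; rewrite !ffunE.
rewrite sym_mul_st; congr st; rewrite /= sympow_mapE; congr symprod.
by apply/ffunP => j; rewrite !ffunE.
Qed.

Definition inv_mul x : SW := sym_mul [ffun j => invmod_val (x j) : SV].

Lemma inv_mul_inv x : inv_mul x \in invariant_tens (sympow_gaction q a).
Proof.
rewrite inE; apply/asboolP => g gG.
rewrite -[LHS]/(dact _ g _) dact_sym_mul //; congr sym_mul.
by apply/ffunP => j; rewrite !ffunE invmodE.
Qed.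

Lemma exists_sym_to_inv : exists phi : {linear sympow q M -> N},
  forall x, invmod_val (phi (symprod x)) = inv_mul x.
Proof.
pose f x : N := Invmod (inv_mul_inv x).
have upd x i (y : M) : [ffun j => invmod_val (fupd x i y j) : SV] =
    fupd [ffun j => invmod_val (x j) : SV] i (invmod_val y).
  by apply/ffunP => j; rewrite !ffunE; case: eqP.
have [x i r y z|x s|phi phiE] := @sympow_lift _ q M N f.
- apply: val_inj; rewrite /= /inv_mul !upd.
  exact: (sym_mul_multilin _ _ (invring_val r)).
- apply: val_inj; rewrite /= /inv_mul /sym_mul.
  under eq_bigr do under eq_bigr do rewrite !ffunE.
  under [RHS]eq_bigr do under eq_bigr do rewrite !ffunE.
  pose C (al : J) : SW := st 1 (symprod [ffun j => e (al j)]).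
  have CP (al : J) : C [ffun j => al (s j)] = C al.
    rewrite /C -[in RHS](symprod_perm _ s); congr (st _ (symprod _)).
    by apply/ffunP => j; rewrite !ffunE.
  exact: (sum_prod_perm (C := C) (fun j b => cf b (invmod_val (x j)))).
by exists phi => x; rewrite phiE.
Qed.

(** By [galois_mod_trace], [c] times each factor of [v_1 ... v_q] is a combination of traces, which
    lie in [M]. Expanding the product of the [q] factors gives the claim, with the exponent [q]. *)
Lemma inv_mul_span c xs (z : SW) : galois_pairs G c xs ->
  exists L : seq (S * {ffun 'I_q -> M}),
    c ^+ q *: z = \sum_(p <- L) p.1 *: inv_mul p.2.
Proof.
move=> xsP; elim/stens_ind: z => [|s w z [L LE]].
  by exists [::]; rewrite scaler0 big_nil.
suff [L' L'E] : exists L : seq (S * {ffun 'I_q -> M}),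
    c ^+ q *: (st 1 w : SW) = \sum_(p <- L) p.1 *: inv_mul p.2.
  exists ([seq (s * p.1, p.2) | p <- L'] ++ L).
  rewrite scalerDr LE big_cat big_map /=; congr (_ + _).
  rewrite scalerA mulrC -scalerA L'E scaler_sumr.
  by apply: eq_bigr => p _; rewrite scalerA.
elim/sympow_ind: w => [|r v w [L' L'E]].
  by exists [::]; rewrite -(scale0r 0) stZr !scale0r scaler0 big_nil.
suff [L2 L2E] : exists L : seq (S * {ffun 'I_q -> M}),
    c ^+ q *: (st 1 (symprod v) : SW) = \sum_(p <- L) p.1 *: inv_mul p.2.
  exists ([seq (r%:A * p.1, p.2) | p <- L2] ++ L').
  rewrite stPr scalerDr L'E big_cat big_map /=; congr (_ + _).
  rewrite scalerA mulrC -scalerA L2E scaler_sumr.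
  by apply: eq_bigr => p _; rewrite scalerA.
pose I := 'I_(size xs); pose p (i : I) := tnth (in_tuple xs) i.
pose X (io : {ffun 'I_q -> I}) : {ffun 'I_q -> M} :=
  [ffun j => trace_elt G_subgroup a ((p (io j)).2 *: st 1 (v j))].
exists [seq (\prod_j (p (io j)).1, X io) | io : {ffun 'I_q -> I}].
rewrite -sym_mul_st -(multilin_scale _ _ sym_mul_multilin) big_image /=.
transitivity (sym_mul [ffun j => \sum_i (p i).1 *:
    mod_trace a ((p i).2 *: st 1 (v j))]).
  congr sym_mul; apply/ffunP => j; rewrite !ffunE.
  rewrite -(galois_mod_trace G_subgroup a _ xsP) (big_tnth _ _ xs).
  by apply: eq_bigr.
rewrite (multilin_expand (fun _ i => (p i).1)
  (fun j i => mod_trace a ((p i).2 *: st 1 (v j))) sym_mul_multilin).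
apply: eq_bigr => io _; congr (_ *: sym_mul _).
by apply/ffunP => j; rewrite !ffunE.
Qed.

Lemma form_inv_mul_inj c xs (f f' : SW -> S) : galois_pairs G c xs -> GRing.lreg c ->
  is_form f -> is_form f' -> (forall x, f (inv_mul x) = f' (inv_mul x)) -> f =1 f'.
Proof.
move=> xsP c_reg fP f'P ff' z; apply: (lregX (n := q) c_reg).
have [L LE] := inv_mul_span z xsP.
rewrite -!is_formZ // LE !is_form_sum //.
by apply: eq_bigr => p _; rewrite ff'.
Qed.

(* Multiplication by [r] on [M] factors through the free module on [I]; as the *)
(* coordinates [f'] are restrictions of [S]-linear forms [f], a multilinear     *)
(* form on [M] then has, up to a power of [r], a visibly [S]-multilinear        *)
(* extension.                                                                  *)
Lemma inv_almost_projective c xs : galois_pairs G c xs -> GRing.lreg c ->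
    GRing.lreg (#|` G|%:R : S) ->
  exists (I : finType) (m : I -> M) (f : I -> SV -> S) (f' : I -> M -> R) (r : R),
  [/\ GRing.lreg (invring_val r), forall i, is_form (f i),
      forall i y, invring_val (f' i y) = f i (invmod_val y)
    & forall y : M, r *: y = \sum_i f' i y *: m i].
Proof.
move=> xsP c_reg G_reg.
have [r [c' rE r_reg]] := exists_invariant_multiple G_subgroup c_reg.
pose I := (B * 'I_(size xs))%type; pose p (i : I) := tnth (in_tuple xs) i.2.
pose g (i : I) (z : SV) : S := c' * (p i).1 * cf i.1 z.
have gP i : is_form (g i).
  by move=> s y z; rewrite /g cf_form mulrDr mulrCA.
have rGE : invring_val (r *+ #|` G|) = #|` G|%:R * invring_val r.
  by rewrite mulr_natl invring_valMn.
exists I, (fun i => trace_elt G_subgroup a ((p i).2 *: st 1 (e i.1))).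
exists (fun i => conj_form a (g i)).
exists (fun i y => Invring (ser_trace_inv G_subgroup (g i (invmod_val y)))).
exists (r *+ #|` G|).
split=> [|i|i y|y].
- by rewrite rGE; exact: lregM.
- exact: conj_form_form.
- by rewrite conj_form_inv.
apply: invmod_inj; rewrite invmod_val_sum /=.
rewrite -[LHS]/(invring_val (r *+ #|` G|) *: (invmod_val y : SV)).
(* Taking the trace of an expansion of [r y] with coefficients [g i] in [S] moves these coefficients
   into [R], at the cost of the factor [|G|], since [r y] is already invariant. *)
transitivity (mod_trace a (invring_val r *: (invmod_val y : SV))).
  by rewrite mod_traceZ_inv // ser_trace_invring // rGE.
transitivity (mod_trace a (\sum_(i : I) g i (invmod_val y) *:
    mod_trace a ((p i).2 *: st 1 (e i.1)))); last first.
  rewrite mod_trace_sum; apply: eq_bigr => i _.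
  by rewrite (mod_traceZ_inv _ (trace_elt G_subgroup a ((p i).2 *: st 1 (e i.1)))).
congr mod_trace; rewrite rE -scalerA {1}(cfE (invmod_val y)) !scaler_sumr.
rewrite -(pair_bigA _ (fun b i => g (b, i) (invmod_val y) *:
  mod_trace a ((p (b, i)).2 *: st 1 (e b)))) /=.
apply: eq_bigr => b _.
rewrite [c *: _]scalerA mulrC -scalerA -(galois_mod_trace G_subgroup a _ xsP).
rewrite (big_tnth _ _ xs).
rewrite !scaler_sumr; apply: eq_bigr => i _.
by rewrite !scalerA /g /p /= mulrAC.
Qed.

Lemma form_multiple_extension c xs (la : sympow q M -> R) :
  is_form la ->
  galois_pairs G c xs -> GRing.lreg c -> GRing.lreg (#|` G|%:R : S) ->
  exists (r : R) (f : SW -> S), [/\ GRing.lreg (invring_val r), is_form f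
    & forall x, f (inv_mul x) = invring_val r * invring_val (la (symprod x))].
Proof.
move=> laP xsP c_reg G_reg.
have [I [m [b [b' [r [r_reg bP b'E rE]]]]]] := inv_almost_projective xsP c_reg G_reg.
pose C (al : {ffun 'I_q -> I}) : S := invring_val (la (symprod [ffun j => m (al j)])).
(* This is [la] on the product of the [r *: x j], each factor being expanded in the [m i], with the
   coordinates [b' i] replaced by the forms [b i] defined on all of [SV]. *)
pose F z : S := \sum_(al : {ffun 'I_q -> I}) (\prod_j b (al j) (z j)) * C al.
have FP : multilin (F : _ -> S^o).
  apply: multilin_sum => al.
  apply: (multilin_prod (X := S^o) (F := fun j (y : SV) => b (al j) y)) => j s y z.
  exact: bP.
(* The restriction of [F] to vectors of [V] is symmetric, so it descends to the symmetric power over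
   [k] and then extends [S]-linearly. *)
pose mu (v : {ffun 'I_q -> V}) : S :=
  \sum_(al : {ffun 'I_q -> I}) (\prod_j b (al j) (st 1 (v j))) * C al.
have [|v s|mul mulE] := @sympow_lift k q V S mu.
- apply: multilin_sum => al.
  apply: (multilin_prod_alg (F := fun j (w : V) => b (al j) (st 1 w))) => j s y z.
  by rewrite stPr bP mulr_algl.
- rewrite /mu; under eq_bigr do under eq_bigr do rewrite !ffunE.
  apply: (sum_prod_perm (X := S^o) (C := C) (fun j i => b i (st 1 (v j)))) => // al.
  rewrite /C -[in RHS](symprod_perm _ s); congr (invring_val (la (symprod _))).
  by apply/ffunP => j; rewrite !ffunE.
have [|f fP fE] := @form_lift n k (sympow q V) mul.
  by move=> s w w'; rewrite linearP mulr_algl.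
exists (r ^+ q), f; split=> // [|x].
  by rewrite invring_valX; exact: lregX.
have fF z : f (sym_mul z) = F z.
  have {2}-> : z = [ffun j => \sum_b cf b (z j) *: st 1 (e b)].
    by apply/ffunP => j; rewrite ffunE -cfE.
  rewrite (multilin_expand (fun j b => cf b (z j)) (fun _ b => st 1 (e b)) FP).
  rewrite is_form_sum //; apply: eq_bigr => al _.
  rewrite fE mul1r mulE; congr (_ * _); apply: eq_bigr => be _.
  by congr (_ * _); apply: eq_bigr => j _; rewrite !ffunE.
rewrite fF -invring_valM -(is_formZ laP).
rewrite -(multilin_scale _ _ (symprod_multilin (M := M))).
have -> : [ffun j => r *: x j] = [ffun j => \sum_i b' i (x j) *: m i].
  by apply/ffunP => j; rewrite !ffunE rE.
rewrite (multilin_expand (fun j i => b' i (x j)) (fun=> m) (symprod_multilin (M := M))).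
rewrite (is_form_sum laP) invring_val_sum; apply: eq_bigr => al _.
rewrite invring_valM invring_val_prod; congr (_ * _).
by apply: eq_bigr => j _; rewrite ffunE -b'E.
Qed.

(** * Removing denominators by coprimality *)

Variables (c d : S) (xs ys : seq (S * S)).
Hypotheses (xsP : galois_pairs G c xs) (ysP : galois_pairs G d ys).
Hypothesis c_reg : GRing.lreg c.
Hypothesis cd_coprime : forall i f h, c ^+ i * f = d ^+ i * h ->
  exists h', h = c ^+ i * h'.
Hypothesis G_neq0 : #|` G|%:R != 0 :> k.

Lemma card_lreg : GRing.lreg (#|` G|%:R : S).
Proof.
move=> s t; rewrite !mulr_natl -!scaler_nat => /(congr1 (fun u => #|` G|%:R^-1 *: u)).
by rewrite !scalerA mulVf // !scale1r.
Qed.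

(* [c ^+ q * f z] and [d ^+ q * f z] are both multiples of [r], hence so is [f z]. *)
Lemma exists_form_extension (la : sympow q M -> R) : is_form la ->
  exists2 f : SW -> S, is_form f
    & forall x, f (inv_mul x) = invring_val (la (symprod x)).
Proof.
move=> laP.
have [r [f [r_reg fP fE]]] := form_multiple_extension laP xsP c_reg card_lreg.
have span c' xs' (z : SW) : galois_pairs G c' xs' ->
    exists A, c' ^+ q * f z = invring_val r * A.
  move=> xsP'; have [L LE] := inv_mul_span z xsP'.
  exists (\sum_(p <- L) p.1 * invring_val (la (symprod p.2))).
  rewrite -is_formZ // LE is_form_sum // mulr_sumr.
  by apply: eq_bigr => p _; rewrite fE mulrCA.
have divr (z : SW) : exists A, f z = invring_val r * A.
  have [A AE] := span _ _ z xsP; have [B' BE] := span _ _ z ysP.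
  have [A' A'E] : exists A', A = c ^+ q * A'.
    apply: (cd_coprime (f := B')); apply: r_reg.
    by rewrite mulrCA -BE mulrCA AE mulrCA.
  exists A'; apply: (lregX (n := q) c_reg).
  by rewrite AE A'E mulrCA.
have /all_sig[psi psiE] (z : SW) := cid (divr z).
exists psi => [s y z|x]; apply: r_reg; last by rewrite -psiE fE.
by rewrite mulrDr mulrCA -!psiE fP.
Qed.

(* [fc xs] and [fc ys] represent [eta (c * _)] and [eta (d * _)], so                *)
(* [d * fc xs = c * fc ys], and the representative of [eta] is [fc xs / c].        *)
Lemma ser_trace_repr (eta : S -> R) :
  (forall r s t, eta (invring_val r * s + t) = r * eta s + eta t) ->
  exists f, forall s, invring_val (eta s) = ser_trace G (s * f).
Proof.
move=> etaP; pose fc (zs : seq (S * S)) := \sum_(p <- zs) invring_val (eta p.1) * p.2.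
have eta0 : eta 0 = 0.
  by have := etaP (-1) 0 0; rewrite mulr0 addr0 mulN1r addNr.
have eta_sum (I : Type) (L : seq I) (r : I -> R) (s : I -> S) :
    eta (\sum_(i <- L) invring_val (r i) * s i) = \sum_(i <- L) r i * eta (s i).
  by elim: L => [|i L IH]; rewrite ?big_nil // !big_cons etaP IH.
have fcE c' zs s : galois_pairs G c' zs ->
    ser_trace G (s * fc zs) = invring_val (eta (c' * s)).
  move=> zsP; rewrite -(galois_ser_trace G_subgroup s zsP) /fc mulr_sumr ser_trace_sum.
  under [X in eta X]eq_bigr => p _ do
    rewrite mulrC -[ser_trace G _]/(invring_val
      (Invring (ser_trace_inv G_subgroup (p.2 * s)))).
  rewrite eta_sum invring_val_sum; apply: eq_bigr => p _.
  rewrite mulrCA ser_traceM invring_valM /= [s * _]mulrC.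
  exact: mulrC.
have [f fE] : exists f, fc xs = c ^+ 1 * f.
  (* The equality [c * fc ys = d * fc xs] is tested, after multiplication by [c], on traces against
     the [p.2]: on both sides these are [eta (c * d * p.2)]. *)
  apply: (cd_coprime (f := fc ys)); apply: c_reg; rewrite !expr1.
  rewrite -(galois_ser_trace G_subgroup (c * fc ys) xsP).
  rewrite -(galois_ser_trace G_subgroup (d * fc xs) xsP).
  apply: eq_bigr => p _; rewrite !mulrA (fcE _ _ _ ysP) (fcE _ _ _ xsP).
  by congr (_ * invring_val (eta _)); rewrite mulrCA [RHS]mulrCA [d * c]mulrC.
(* It suffices to compare after multiplication by the invariant multiple [r = c' * c], where [fcE]
   computes [eta (r * s)]. *)
exists f => s; have [r [c' rE r_reg]] := exists_invariant_multiple G_subgroup c_reg.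
apply: r_reg; rewrite -ser_traceM -invring_valM.
have -> : r * eta s = eta (invring_val r * s + 0) by rewrite etaP eta0 addr0.
rewrite addr0 rE [c' * c]mulrC -[c * _ * s]mulrA -(fcE _ _ _ xsP) fE expr1.
by congr ser_trace; rewrite [c * c']mulrC mulrACA.
Qed.

(** * The map from the invariants to the bidual *)

Local Notation T := (sympow q M).
Implicit Types (la : dual T) (y : N) (w : SW).

Lemma exists_dual_extension (la : dual T) :
  exists f : SW -> S, is_form f /\ forall x, f (inv_mul x) = invring_val (la (symprod x)).
Proof. by have [f fP fE] := exists_form_extension (dual_form la); exists f. Qed.

Definition ext (la : dual T) : SW -> S := projT1 (cid (exists_dual_extension la)).

Lemma ext_form la : is_form (ext la).
Proof. by rewrite /ext; case: cid => f []. Qed.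

Lemma ext_inv_mul la x : ext la (inv_mul x) = invring_val (la (symprod x)).
Proof. by rewrite /ext; case: cid => f []. Qed.

Lemma ext_unique la (f : SW -> S) : is_form f ->
  (forall x, f (inv_mul x) = invring_val (la (symprod x))) -> ext la =1 f.
Proof.
move=> fP fE; apply: (form_inv_mul_inj xsP c_reg) => // [|x]; first exact: ext_form.
by rewrite ext_inv_mul fE.
Qed.

Lemma extP r la la' w : ext (r *: la + la') w = invring_val r * ext la w + ext la' w.
Proof.
move: w; apply: ext_unique => [s y z|x].
  rewrite !ext_form mulrDr mulrDr mulrCA -!addrA; congr (_ + _).
  by rewrite addrCA.
by rewrite dual_linE invring_valD invring_valM (ext_inv_mul la) (ext_inv_mul la').
Qed.

(** Conjugating [ext la] by [g] gives another extension of [la], because products of invariants are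
    invariant and [la] takes values in [R]; uniqueness identifies the two. *)
Lemma ext_dact la g w : g \in G ->
  ext la (dact (sympow_gaction q a) g w) = linsub g (ext la w).
Proof.
move=> gG.
rewrite -[LHS](linsubVK G_subgroup _ gG); congr (linsub g _); apply/esym.
move: w; apply: ext_unique => [s y z|x].
  by rewrite dactD dactZ ext_form rmorphD rmorphM /= (linsubK G_subgroup _ gG).
rewrite -[inv_mul x]/(invmod_val (Invmod (inv_mul_inv x)) : SW) invmodE //=.
by rewrite ext_inv_mul invringE // (subgroupV G_subgroup).
Qed.

Lemma ext_inv la (y : N) : ext la (invmod_val y) \in invariant_series G.
Proof.
by rewrite inE; apply/asboolP => g gG; rewrite -ext_dact // invmodE.
Qed.

Lemma bidual_form y : is_form (fun la => Invring (ext_inv la y)).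
Proof.
move=> r la la'; apply: invring_inj; rewrite invring_valD invring_valM /=.
exact: extP.
Qed.

Definition to_bidual y : dual (dual T) := form_dual (bidual_form y).

Lemma to_bidualE y la : invring_val (to_bidual y la) = ext la (invmod_val y).
Proof. by rewrite /to_bidual form_dualE. Qed.

Lemma to_bidual_linear : linear to_bidual.
Proof.
move=> r y y'; apply: dual_ext => la; apply: invring_inj.
rewrite dual_linE invring_valD invring_valM !to_bidualE invmod_val_lin.
exact: ext_form.
Qed.

Variable phi : {linear T -> N}.
Hypothesis phiE : forall x, invmod_val (phi (symprod x)) = inv_mul x.

Lemma ext_phi la t : ext la (invmod_val (phi t)) = invring_val (la t).
Proof.
elim/sympow_ind: t => [|r x t IH].
  by rewrite linear0 (is_form0 (ext_form la)) (is_form0 (dual_form la)).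
rewrite (dual_form la) linearP invmod_val_lin ext_form IH phiE ext_inv_mul.
by rewrite invring_valD invring_valM.
Qed.

Variables (B' : finType) (e' : B' -> sympow q V) (cf' : B' -> SW -> S).
Hypothesis cf'_form : forall b, is_form (cf' b).
Hypothesis cf'E : forall w, w = \sum_b cf' b w *: st 1 (e' b).

Lemma trace_form_form s b : is_form (fun t : T =>
  Invring (ser_trace_inv G_subgroup (s * cf' b (invmod_val (phi t))))).
Proof.
move=> r t t'; apply: invring_inj; rewrite invring_valD invring_valM /=.
rewrite -ser_traceM // -ser_traceD linearP invmod_val_lin cf'_form.
by rewrite mulrDr mulrCA.
Qed.

(** These forms separate the points of [N], and their sums contain [|G|] times every form on [T];
    they serve for both injectivity and surjectivity. *)
Definition trace_form s b : dual T := form_dual (trace_form_form s b).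

Lemma trace_formE s b t :
  invring_val (trace_form s b t) = ser_trace G (s * cf' b (invmod_val (phi t))).
Proof. by rewrite /trace_form form_dualE. Qed.

(** The extension is the sum of the conjugates of [s * cf' b], by uniqueness. *)
Lemma ext_trace_form s b (y : N) :
  ext (trace_form s b) (invmod_val y) = ser_trace G (s * cf' b (invmod_val y)).
Proof.
have fP : is_form (fun w => s * cf' b w).
  by move=> t z z'; rewrite cf'_form mulrDr mulrCA.
rewrite -(conj_form_inv G_subgroup (fun w => s * cf' b w)).
apply: ext_unique => [|x]; first exact: conj_form_form.
by rewrite -phiE conj_form_inv //; exact/esym/trace_formE.
Qed.

(** The values of [to_bidual y] at the [trace_form p.2 b] are the traces of [p.2 * cf' b y], which
    by [galois_ser_trace] determine the coordinates of [y]. *)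
Lemma to_bidual_inj : injective to_bidual.
Proof.
move=> y y' E; apply: invmod_inj.
rewrite [LHS]cf'E [RHS]cf'E; apply: eq_bigr => b _; congr (_ *: _).
apply: c_reg; rewrite -!(galois_ser_trace G_subgroup _ xsP).
apply: eq_bigr => p _; congr (_ * _); rewrite -!ext_trace_form.
exact: (congr1 (fun xi : dual (dual T) => invring_val (xi (trace_form p.2 b) : R)) E).
Qed.

(** For each [b], the map [s |-> xi (trace_form s b)] is [R]-linear from [S] to [R], hence of the
    form [s |-> tr (s * f b)]. The [f b] are the coordinates of an element whose average over [G] is
    the preimage. *)
Lemma to_bidual_surj (xi : dual (dual T)) : exists y, to_bidual y = xi.
Proof.
have xiP := dual_form xi.
have reprb b : exists f, forall s, invring_val (xi (trace_form s b)) = ser_trace G (s * f).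
  apply: (ser_trace_repr (eta := fun s => xi (trace_form s b))) => r s t.
  rewrite -xiP; congr (xi _); apply: dual_ext => u; apply: invring_inj.
  rewrite dual_linE invring_valD invring_valM !trace_formE.
  by rewrite mulrDl ser_traceD -mulrA ser_traceM.
have /all_sig[f fE] b := cid (reprb b).
pose y0 : SW := \sum_b f b *: st 1 (e' b).
pose y := trace_elt G_subgroup (sympow_gaction q a) y0.
pose gi : S := #|` G|%:R^-1 *: 1.
have giP : gi \in invariant_series G.
  by rewrite inE; apply/asboolP => g _; rewrite linearZ /= rmorph1.
have giK : #|` G|%:R * gi = 1 by rewrite mulr_natl -scaler_nat scalerA mulfV // scale1r.
exists (Invring giP *: y); apply: dual_ext => la; apply: invring_inj; rewrite to_bidualE.
rewrite -[invmod_val _]/(gi *: (mod_trace (sympow_gaction q a) y0 : SW)).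
rewrite (is_formZ (ext_form la)) (equivariant_mod_trace _ (ext_form la)); last first.
  by move=> g z gG; exact: ext_dact.
apply: card_lreg; rewrite mulrA giK mul1r.
have natE (r : R) : invring_val (#|` G|%:R * r) = #|` G|%:R * invring_val r.
  by rewrite !mulr_natl invring_valMn.
(* On [R] the trace is multiplication by [|G|]; so [|G| la t] is the trace of [ext la (phi t)],
   which is then expanded in the coordinates [cf']. *)
have sum_la : (#|` G|%:R : R) *: la = \sum_b (1 : R) *: trace_form (ext la (st 1 (e' b))) b.
  apply: dual_ext => t; apply: invring_inj.
  rewrite dual_scaleE natE -ser_trace_invring // dual_sumE.
  rewrite invring_val_sum -ext_phi {1}(cf'E (invmod_val (phi t))).
  rewrite (is_form_sum (ext_form la)) ser_trace_sum; apply: eq_bigr => b _.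
  by rewrite scale1r trace_formE mulrC.
rewrite -natE -(is_formZ xiP) sum_la (is_form_sum xiP) invring_val_sum.
rewrite (is_form_sum (ext_form la)) ser_trace_sum.
by apply: eq_bigr => b _; rewrite mul1r fE mulrC.
Qed.

Lemma bidual_iso : exists f : {linear dual (dual T) -> N}, bijective f.
Proof.
have /all_sig[g gK] xi := cid (to_bidual_surj xi).
have Kg : cancel to_bidual g by move=> y; apply: to_bidual_inj; exact: gK.
have gP : linear g.
  by move=> r xi xi'; apply: to_bidual_inj; rewrite to_bidual_linear !gK.
pose f : {linear dual (dual T) -> N} :=
  HB.pack g (GRing.isLinear.Build R (dual (dual T)) N *:%R g gP).
by exists f, to_bidual.
Qed.

End SymmetricProduct.

(** * Small subgroups in dimension two *)

Lemma natr_neq0_pchar (k : fieldType) m : (0 < m)%N ->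
  (forall p : nat, p \in [pchar k] -> ~~ (p %| m)%N) -> m%:R != 0 :> k.
Proof.
move=> m_gt0 m_char; apply/negP => /[dup] m0 /(natf0_pchar m_gt0)[p pk].
by have /negP := m_char p pk; apply; rewrite (dvdn_pcharf pk).
Qed.

Theorem theorem2p12 (k : closedFieldType) (G : {fset 'M[k]_2})
    (G_subgroup : GL_subgroup G) (G_small : small G)
    (G_char : forall p : nat, p \in [pchar k] -> ~~ (p %| #|` G|)%N)
    (V : vectType k) (a : gaction G V) (q : nat) :
  exists f : {linear dual (dual (sympow q (invmod a)))
                     -> invmod (sympow_gaction q a)},
    bijective f.
Proof.
have G1 := subgroup1 G_subgroup.
have uG g : g \in G -> g != 1%:M -> g - 1%:M \in unitmx.
  by move=> gG g1; apply: nonreflection_unit => //; exact: G_small.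
(* The indices 0 and 1 are the two variables; their powers serve as the coprime series [c] and
   [d]. *)
have [xs xsP] := exists_galois_pairs 0 G1 uG.
have [ys ysP] := exists_galois_pairs 1 G1 uG.
have eE := @vect_dual_basis k V.
have [cf [cf_form cfE cf_st]] := exists_coordinates 2 eE.
have [eps' eE'] := sympow_dual_basis q eE.
have [cf' [cf'_form cf'E _]] := exists_coordinates 2 eE'.
have [phi phiE] := exists_sym_to_inv a q eE cf_form cfE cf_st.
apply: (bidual_iso G_subgroup eE cf_form cfE cf_st xsP ysP _ _ _ phiE cf'_form cf'E).
- by apply: lregX; exact: pmon_lreg.
- by move=> i f h; rewrite -!exprM => /esym; exact: pmon_coprime.
- by apply: natr_neq0_pchar => //; rewrite cardfs_gt0; apply/fset0Pn; exists 1%:M.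
Qed.
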